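(* Let $R$ be a field, let $(\mathcal G,\Gamma)$ be a Hecke pair with $\Gamma$ finitely generated, let $\mathcal P\subset\mathcal G$ be a conjugation-invariant subset, let $V$ be an $R[\mathcal G]$-module and let $q\ge 1$ be an integer. Then there is a natural injection of smooth $\mathcal G$-modules $$L_q(\mathcal P,V)\ \hookrightarrow\ \widehat{\mathrm{Hom}}_{\mathcal P}^{\otimes (q-1)}\otimes V^\infty ,$$ where the tensor products are over $R$.
   Context: A Hecke pair $(\mathcal G,\Gamma)$ is a group $\mathcal G$ with a subgroup $\Gamma$ such that $\Gamma g\Gamma/\Gamma$ is finite for every $g\in\mathcal G$. A congruence subgroup of $\Gamma$ is a subgroup of $\Gamma$ containing a group of the form $\Gamma\cap g_1\Gamma g_1^{-1}\cap\dots\cap g_n\Gamma g_n^{-1}$ with $g_1,\dots,g_n\in\mathcal G$. $\mathcal G$ is made a topological group with the congruence subgroups as a unit neighborhood base. An element of an $R[\mathcal G]$-module is smooth if it is fixed by some congruence subgroup; $V^\infty$ is the submodule of smooth elements of $V$, and a module is smooth if all its elements are smooth. For a group $\Sigma$, a conjugation-invariant subset $P\subset \Sigma$, an $R[\Sigma]$-module $V$ and $q\in\mathbb N$, let $\mathrm H^0_q(\Sigma,P,V)$ be the set of all $v\in V$ with $I^q v=0$ and $pv=v$ for every $p\in P$, where $I$ is the augmentation ideal of $R[\Sigma]$; set $\mathrm H^0_0(\Sigma,P,V)=0$ and $$\overline{\mathrm H}_q(\Sigma,P,V)=\mathrm H^0_q(\Sigma,P,V)/\mathrm H^0_{q-1}(\Sigma,P,V).$$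 For a subgroup $\Sigma\subset\Gamma$ write $\overline{\mathrm H}_q(\Sigma,\mathcal P,V)$ for $\overline{\mathrm H}_q(\Sigma,\mathcal P\cap\Sigma,V)$. Put $$L_q(\mathcal P,V)=\varinjlim_\Sigma \overline{\mathrm H}_q(\Sigma,\mathcal P,V),$$ the direct limit over all congruence subgroups $\Sigma$ of $\Gamma$ with respect to the restriction maps. The element $g\in\mathcal G$ acts on $L_q(\mathcal P,V)$ through the maps $\overline{\mathrm H}_q(\Sigma,\mathcal P,V)\to\overline{\mathrm H}_q(g\Sigma g^{-1},\mathcal P,V)\to\overline{\mathrm H}_q(\Sigma\cap g\Sigma g^{-1},\mathcal P,V)$, the first being $v\mapsto gv$ and the second restriction; this makes $L_q(\mathcal P,V)$ a smooth module. $\mathrm{Hom}_{\mathcal P}(\Sigma,R)$ is the set of group homomorphisms $\Sigma\to (R,+)$ vanishing on $\Sigma\cap\mathcal P$, and $\widehat{\mathrm{Hom}}_{\mathcal P}=\varinjlim_\Sigma\mathrm{Hom}_{\mathcal P}(\Sigma,R)$, the limit over all congruence subgroups with respect to restriction. It is a smooth $\mathcal G$-module through the maps $\mathrm{Hom}_{\mathcal P}(\Sigma,R)\to\mathrm{Hom}_{\mathcal P}(g\Sigma g^{-1},R)\to\mathrm{Hom}_{\mathcal P}(\Sigma\cap g\Sigma g^{-1},R)$ given by conjugation and restriction. The injection is the one induced by iterating the order-lowering maps $\overline{\mathrm H}_q(\Sigma,\mathcal P,V)\to\mathrm{Hom}_{\mathcal P}(\Sigma,\overline{\mathrm H}_{q-1}(\Sigma,\mathcal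 P,V))\cong\mathrm{Hom}_{\mathcal P}(\Sigma,R)\otimes\overline{\mathrm H}_{q-1}(\Sigma,\mathcal P,V)$, $v\mapsto(\gamma\mapsto(\gamma-1)v)$. *)

(* Defs.v *)
From HB Require Import structures.
From mathcomp Require Import ssreflect ssrfun ssrbool eqtype ssrnat seq choice.
From mathcomp Require Import bigop generic_quotient monoid ssralg ring_quotient.
From mathcomp Require Import boolp classical_sets functions cardinality.
From mathcomp Require Import freeg.

Set Implicit Arguments.
Unset Strict Implicit.
Unset Printing Implicit Defensive.

Import GRing.Theory.
Local Open Scope ring_scope.
Local Open Scope quotient_scope.

Definition mk_linear (R : pzRingType) (U V : lmodType R) (f : U -> V)
    (fL : linear f) : {linear U -> V} :=
  HB.pack f (GRing.isLinear.Build R U V *:%R f fL).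

Section SubQuot.
Variables (R : pzRingType) (V : lmodType R).

Lemma submodN (S : submodClosed V) v : v \in S -> - v \in S.
Proof. by move=> Sv; rewrite -scaleN1r rpredZ. Qed.

Record submod (S : submodClosed V) :=
  Submod { submod_val : V; submod_valP : submod_val \in S }.

Section Sub.
Variable S : submodClosed V.
HB.instance Definition _ := [isSub for @submod_val S].
HB.instance Definition _ := [Choice of submod S by <:].
HB.instance Definition _ := [SubChoice_isSubLmodule of submod S by <:].
End Sub.

Section Quot.
Variable S : submodClosed V.

Fact submod_zmod_closed : zmod_closed (fun v => v \in S).
Proof.
split=> [|x y Sx Sy]; first exact: rpred0.
by apply: rpredD => //; apply: submodN.
Qed.

Definition zmod_of_submod : zmodClosed V :=
  HB.pack (fun v => v \in S)
    (GRing.isZmodClosed.Build V (fun v => v \in S) submod_zmod_closed).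

Definition quotmod : Type := Quotient.quot zmod_of_submod.
HB.instance Definition _ := Choice.on quotmod.
HB.instance Definition _ := GRing.Zmodule.on quotmod.

Definition quot_pi (v : V) : quotmod := \pi_(Quotient.quot zmod_of_submod) v.

Lemma quot_pi_eq v w : quot_pi v = quot_pi w <-> v - w \in S.
Proof.
have e := Quotient.idealrBE zmod_of_submod v w.
by split=> [vw|Svw]; [move: e; rewrite [X in _ == X](esym vw) eqxx | apply/eqP; rewrite -e].
Qed.

Lemma quot_ind z : exists v, z = quot_pi v.
Proof. by exists (repr z); rewrite /quot_pi reprK. Qed.

Lemma quot_piD v w : quot_pi (v + w) = quot_pi v + quot_pi w.
Proof. by rewrite /quot_pi -(raddfD (\pi_(Quotient.quot zmod_of_submod))). Qed.

Definition quot_scale a (z : quotmod) : quotmod := quot_pi (a *: repr z).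

Lemma quot_reprP v : repr (quot_pi v) - v \in S.
Proof. by apply/quot_pi_eq; rewrite /quot_pi reprK. Qed.

Lemma quot_scaleE a v : quot_scale a (quot_pi v) = quot_pi (a *: v).
Proof. by apply/quot_pi_eq; rewrite -scalerBr rpredZ // quot_reprP. Qed.

Fact quot_scaleA a b z : quot_scale a (quot_scale b z) = quot_scale (a * b) z.
Proof. by have [v ->] := quot_ind z; rewrite !quot_scaleE scalerA. Qed.
Fact quot_scale1 : left_id 1 quot_scale.
Proof. by move=> z; have [v ->] := quot_ind z; rewrite !quot_scaleE scale1r. Qed.
Fact quot_scaleDr : right_distributive quot_scale +%R.
Proof.
move=> a z t; have [v ->] := quot_ind z; have [w ->] := quot_ind t.
by rewrite -quot_piD !quot_scaleE -quot_piD scalerDr.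
Qed.
Fact quot_scaleDl z : {morph quot_scale^~ z : a b / a + b}.
Proof.
move=> a b; have [v ->] := quot_ind z.
by rewrite !quot_scaleE -quot_piD scalerDl.
Qed.

HB.instance Definition _ := GRing.Zmodule_isLmodule.Build R quotmod
  quot_scaleA quot_scale1 quot_scaleDr quot_scaleDl.

Fact quot_pi_linear : linear quot_pi.
Proof. by move=> a v w; rewrite quot_piD -quot_scaleE. Qed.
HB.instance Definition _ :=
  GRing.isLinear.Build R V quotmod *:%R quot_pi quot_pi_linear.

Lemma quot_pi_eq0 v : v \in S -> quot_pi v = 0.
Proof. by move=> Sv; rewrite -(linear0 quot_pi); apply/quot_pi_eq; rewrite subr0. Qed.

Section Lift.
Variables (W : lmodType R) (f : {linear V -> W}).
Hypothesis fS : forall v, v \in S -> f v = 0.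

Definition quot_lift_fun (z : quotmod) : W := f (repr z).

Fact quot_lift_funE v : quot_lift_fun (quot_pi v) = f v.
Proof. by apply/eqP; rewrite -subr_eq0 -linearB fS // quot_reprP. Qed.

Fact quot_lift_linear : linear quot_lift_fun.
Proof.
move=> a z t; have [v ->] := quot_ind z; have [w ->] := quot_ind t.
by rewrite -linearP !quot_lift_funE linearP.
Qed.

Definition quot_lift : {linear quotmod -> W} := mk_linear quot_lift_linear.

Lemma quot_liftE v : quot_lift (quot_pi v) = f v.
Proof. exact: quot_lift_funE. Qed.
End Lift.
End Quot.

Definition span (A : set V) : {pred V} :=
  fun v => `[< forall S : submodClosed V, (forall a, A a -> a \in S) -> v \in S >].

Fact span_submod A : submod_closed (span A).
Proof.
split=> [|a v w /asboolP Av /asboolP Aw]; apply/asboolP => S AS.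
  exact: rpred0.
by apply: rpredD; [apply: rpredZ; apply: Av | apply: Aw].
Qed.
HB.instance Definition _ A := GRing.isSubmodClosed.Build R V (span A)
  (GRing.submod_closed_semi (span_submod A)).

Lemma mem_span (A : set V) a : A a -> a \in span A.
Proof. by move=> Aa; apply/asboolP => S; apply. Qed.

Lemma span_min (A : set V) (S : submodClosed V) v :
  (forall a, A a -> a \in S) -> v \in span A -> v \in S.
Proof. by move=> AS /asboolP; apply. Qed.

End SubQuot.

Section KerPred.
Variables (R : pzRingType) (V W : lmodType R) (f : {linear V -> W}).
Definition ker_pred : {pred V} := fun v => f v == 0.
Fact ker_submod : submod_closed ker_pred.
Proof.
split=> [|a v w]; rewrite !unfold_in ?linear0 // => /eqP v0 /eqP w0.
by rewrite linearP v0 w0 scaler0 addr0.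
Qed.
HB.instance Definition _ := GRing.isSubmodClosed.Build R V ker_pred
  (GRing.submod_closed_semi ker_submod).

Lemma span_ker (A : set V) v :
  (forall a, A a -> f a = 0) -> v \in span A -> f v = 0.
Proof.
by move=> Af /(@span_min _ _ _ ker_pred) H; apply/eqP/H => a /Af af; apply/eqP.
Qed.
End KerPred.

Section SubqDef.
Variables (R : pzRingType) (V : lmodType R) (A B : submodClosed V).

Definition subq_rel : {pred submod A} := fun v => val v \in B.
Fact subq_rel_submod : submod_closed subq_rel.
Proof.
have inE v : (v \in subq_rel) = (val v \in B) by [].
split=> [|a v w]; rewrite !inE; first by rewrite raddf0 rpred0.
by move=> Bv Bw; rewrite linearP /=; apply: rpredD => //; apply: rpredZ.
Qed.
HB.instance Definition _ := GRing.isSubmodClosed.Build R (submod A) subq_rel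
  (GRing.submod_closed_semi subq_rel_submod).

Definition subq : lmodType R := quotmod subq_rel.

Definition subq_class v (Av : v \in A) : subq := quot_pi subq_rel (Submod Av).

Lemma subq_ind (z : subq) : exists v (Av : v \in A), z = subq_class Av.
Proof. by have [[v Av] ->] := quot_ind z; exists v, Av. Qed.

Lemma subq_class_eq v w (Av : v \in A) (Aw : w \in A) :
  subq_class Av = subq_class Aw <-> v - w \in B.
Proof. exact: quot_pi_eq. Qed.

Section Lift.
Variables (W : lmodType R) (f : {linear submod A -> W}).
Hypothesis fB : forall v (Av : v \in A), v \in B -> f (Submod Av) = 0.
Fact subq_lift_subproof v : v \in subq_rel -> f v = 0.
Proof. by case: v => v Av; apply: fB. Qed.
Definition subq_lift : {linear subq -> W} := quot_lift subq_lift_subproof.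
Lemma subq_liftE v (Av : v \in A) : subq_lift (subq_class Av) = f (Submod Av).
Proof. exact: quot_liftE. Qed.
End Lift.
End SubqDef.
Arguments subq_rel {R V} A B _.

Section SubMap.
Variables (R : pzRingType) (V V' : lmodType R) (f : {linear V -> V'}).
Variables (A : submodClosed V) (A' : submodClosed V').
Hypothesis fA : forall v, v \in A -> f v \in A'.

Definition sub_map_fun (v : submod A) : submod A' := Submod (fA (submod_valP v)).
Fact sub_map_linear : linear sub_map_fun.
Proof. by move=> a v w; apply: val_inj; rewrite /= !linearP. Qed.
Definition sub_map : {linear submod A -> submod A'} := mk_linear sub_map_linear.
End SubMap.

Section SubqMap.
Variables (R : pzRingType) (V V' : lmodType R) (f : {linear V -> V'}).
Variables (A B : submodClosed V) (A' B' : submodClosed V').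
Hypothesis fA : forall v, v \in A -> f v \in A'.
Hypothesis fB : forall v, v \in B -> f v \in B'.

Definition subq_map_pre : {linear submod A -> subq A' B'} :=
  quot_pi (subq_rel A' B') \o sub_map fA.
Fact subq_map_subproof v (Av : v \in A) : v \in B -> subq_map_pre (Submod Av) = 0.
Proof. by move=> Bv; apply: quot_pi_eq0; apply: fB. Qed.

Definition subq_map : {linear subq A B -> subq A' B'} := subq_lift subq_map_subproof.

Lemma subq_mapE v (Av : v \in A) : subq_map (subq_class B Av) = subq_class B' (fA Av).
Proof. by rewrite /subq_map subq_liftE. Qed.
End SubqMap.

Section Fglift.
Variables (R : nzRingType) (K : choiceType) (M : lmodType R) (f : K -> M).

Fact fglift_is_linear : linear (fglift f : {freeg K / R} -> M).
Proof.
have fD := lift_is_additive f.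
have f0 : fglift f 0 = 0 :> M by rewrite -[X in fglift f X](subrr 0) fD subrr.
have fA x y : fglift f (x + y) = fglift f x + fglift f y :> M.
  by rewrite -[y in LHS]opprK fD -[- y]add0r fD f0 add0r opprK.
have fU c x : fglift f (<< c *g x >>) = c *: f x by rewrite liftU.
have fS (I : Type) (s : seq I) (F : I -> {freeg K / R}) :
    fglift f (\sum_(i <- s) F i) = \sum_(i <- s) fglift f (F i).
  by elim: s => [|i s IHs]; rewrite ?big_nil ?f0 // !big_cons fA IHs.
move=> a x y; rewrite fA; congr (_ + _).
have -> : a *: x = \sum_(z <- dom x) << a * coeff z x *g z >> by [].
rewrite fS -[x in RHS]freeg_sumE fS scaler_sumr.
by apply: eq_bigr => z _; rewrite !fU scalerA.
Qed.

Definition free_lift : {linear {freeg K / R} -> M} := mk_linear fglift_is_linear.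
Lemma free_liftU x : free_lift << x >> = f x.
Proof. by rewrite /= liftU scale1r. Qed.

Lemma free_ext (g h : {linear {freeg K / R} -> M}) :
  (forall x, g << x >> = h << x >>) -> g =1 h.
Proof.
move=> gh x; rewrite -[x]freeg_sumE !linear_sum; apply: eq_bigr => z _.
have -> : << coeff z x *g z >> = coeff z x *: << z >> :> {freeg K / R}.
  by apply/eqP/freeg_eqP => y; rewrite coeffZ !coeffU mul1r.
by rewrite !linearZ gh.
Qed.
End Fglift.

Section Tensor.
Variables (R : fieldType) (M N : lmodType R).

Inductive tensor_rel : set {freeg (M * N) / R} :=
| TensorRelL a m m' n :
    tensor_rel (<< (a *: m + m', n) >> - a *: << (m, n) >> - << (m', n) >>)
| TensorRelR a m n n' :
    tensor_rel (<< (m, a *: n + n') >> - a *: << (m, n) >> - << (m, n') >>).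

Definition tensor : lmodType R := quotmod (span tensor_rel).
Definition tens (m : M) (n : N) : tensor := quot_pi (span tensor_rel) << (m, n) >>.

Lemma tens_linearl n : linear (tens^~ n).
Proof.
move=> a m m'; rewrite /tens -linearP; apply/quot_pi_eq.
by rewrite opprD addrA; apply: mem_span; exact: TensorRelL.
Qed.
Lemma tens_linearr m : linear (tens m).
Proof.
move=> a n n'; rewrite /tens -linearP; apply/quot_pi_eq.
by rewrite opprD addrA; apply: mem_span; exact: TensorRelR.
Qed.

Section Lift.
Variables (W : lmodType R) (f : M -> N -> W).
Hypothesis fl : forall n, linear (f^~ n).
Hypothesis fr : forall m, linear (f m).

Fact tens_lift_subproof z : z \in span tensor_rel ->
  free_lift (fun x : M * N => f x.1 x.2) z = 0.
Proof.
apply: span_ker => _ [a m m' n|a m n n']; rewrite !linearB linearZ_LR !free_liftU /=.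
  by rewrite fl -addrA -opprD subrr.
by rewrite fr -addrA -opprD subrr.
Qed.
Definition tens_lift : {linear tensor -> W} := quot_lift tens_lift_subproof.
Lemma tens_liftE m n : tens_lift (tens m n) = f m n.
Proof. by rewrite /tens_lift /tens quot_liftE free_liftU. Qed.
End Lift.

Lemma tens_ext (W : lmodType R) (g h : {linear tensor -> W}) :
  (forall m n, g (tens m n) = h (tens m n)) -> g =1 h.
Proof.
move=> gh z; have [x ->] := quot_ind z.
apply: (free_ext (g := g \o quot_pi _) (h := h \o quot_pi _)).
by case=> m n; apply: gh.
Qed.
End Tensor.

Section TensorMap.
Variables (R : fieldType) (M M' N N' : lmodType R).
Variables (f : {linear M -> M'}) (g : {linear N -> N'}).

Fact tens_mapl n : linear (fun m => tens (f m) (g n)).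
Proof. by move=> a m m'; rewrite linearP tens_linearl. Qed.
Fact tens_mapr m : linear (fun n => tens (f m) (g n)).
Proof. by move=> a n n'; rewrite linearP tens_linearr. Qed.
Definition tens_map : {linear tensor M N -> tensor M' N'} :=
  tens_lift tens_mapl tens_mapr.
Lemma tens_mapE m n : tens_map (tens m n) = tens (f m) (g n).
Proof. exact: tens_liftE. Qed.
End TensorMap.

(** [tpow M n N] is M^{(x)n} (x) N, bracketed as M (x) (M (x) ... (M (x) N)). *)
Fixpoint tpow (R : fieldType) (M : lmodType R) n (N : lmodType R) : lmodType R :=
  if n is n'.+1 then tensor M (tpow M n' N) else N.

Fixpoint tpow_map (R : fieldType) (M M' N N' : lmodType R)
    (f : {linear M -> M'}) (g : {linear N -> N'}) n :
    {linear tpow M n N -> tpow M' n N'} :=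
  if n is n'.+1 then tens_map f (tpow_map f g n') else g.

Section Groups.
Variable G : groupType.

Definition left_coset (H : {pred G}) (g : G) : set G :=
  [set (g * h)%g | h in [set` H]].

Definition double_coset (H : {pred G}) (g : G) : set G :=
  [set (a * g * b)%g | a in [set` H] & b in [set` H]].

Definition hecke_pair (Gamma : groupClosed G) : Prop :=
  forall g, finite_set (left_coset Gamma @` double_coset Gamma g).

Definition finitely_generated (H : groupClosed G) : Prop :=
  exists2 s : seq G, {subset s <= H} &
    forall K : groupClosed G, {subset s <= K} -> {subset H <= K}.

(** [x ^ g] is [g^-1 * x * g]. *)
Definition conj_invariant (P : {pred G}) : Prop :=
  forall g x, x \in P -> (x ^ g)%g \in P.

(** The intersection of [S] with [g S' g^-1]. *)
Section CapJ.
Variables (S S' : groupClosed G) (g : G).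
Definition capJ : {pred G} := fun x => (x \in S) && ((x ^ g)%g \in S').

Fact capJ_group : group_closed capJ.
Proof.
have inE x : (x \in capJ) = (x \in S) && ((x ^ g)%g \in S') by [].
split=> [|x y]; rewrite !inE ?conj1g ?gpred1 //.
by case/andP=> xS xS' /andP[yS yS']; rewrite conjMg conjVg !gpredF.
Qed.
HB.instance Definition _ :=
  isMulClosed.Build G capJ (group_closedM capJ_group).
HB.instance Definition _ := isMul1Closed.Build G capJ (proj1 capJ_group).
HB.instance Definition _ := isInvClosed.Build G capJ (group_closedV capJ_group).
End CapJ.

Record subgrp (S : groupClosed G) :=
  Subgrp { subgrp_val : G; subgrp_valP : subgrp_val \in S }.
Section Subgrp.
Variable S : groupClosed G.
HB.instance Definition _ := [isSub for @subgrp_val S].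
HB.instance Definition _ := [Choice of subgrp S by <:].
Fact subgrp_closed : group_closed (fun x => x \in S).
Proof. by split; [exact: gpred1 | exact: gpredF]. Qed.
HB.instance Definition _ :=
  SubChoice_isSubGroup.Build G (fun x => x \in S) (subgrp S) subgrp_closed.
End Subgrp.

End Groups.

Section Congruence.
Variables (G : groupType) (Gamma : groupClosed G).

(** [S] is contained in [Gamma] and contains the intersection of [Gamma] with
    finitely many conjugates [g Gamma g^-1]. *)
Definition is_congruence (S : groupClosed G) : Prop :=
  {subset S <= Gamma} /\
  exists s : seq G, forall x, x \in Gamma ->
    (forall g, g \in s -> (x ^ g)%g \in Gamma) -> x \in S.

Record cong := Cong { cong_grp :> groupClosed G; congP : is_congruence cong_grp }.
HB.instance Definition _ := gen_eqMixin cong.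
HB.instance Definition _ := gen_choiceMixin cong.

Fact cong_top_subproof : is_congruence Gamma.
Proof. by split=> //; exists [::]. Qed.
Definition cong_top : cong := Cong cong_top_subproof.

Fact cong_capJ_subproof (S S' : cong) g : is_congruence (capJ S S' g).
Proof.
have [SG [s sP]] := congP S; have [_ [s' s'P]] := congP S'.
split=> [x /andP[xS _]|]; first exact: SG.
exists (s ++ g :: [seq (g * h)%g | h <- s']) => x xG H; apply/andP; split.
  by apply: sP => // h hs; apply: H; rewrite mem_cat hs.
apply: s'P => [|h hs]; first by apply: H; rewrite mem_cat mem_head orbT.
rewrite -conjgM; apply: H.
by rewrite mem_cat inE map_f ?orbT.
Qed.
Definition cong_capJ (S S' : cong) g : cong := Cong (cong_capJ_subproof S S' g).

(** [csub g S S'] says that [S'] is contained in [g S g^-1]. *)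
Definition csub g (S S' : cong) : Prop := forall x, x \in S' -> (x ^ g)%g \in S.

Lemma csub_refl S : csub 1%g S S. Proof. by move=> x; rewrite conjg1. Qed.
Lemma csub_trans g h S S' S'' : csub h S S' -> csub g S' S'' -> csub (g * h)%g S S''.
Proof. by move=> p q x /q /p; rewrite -conjgM. Qed.
Lemma csub_capl S S' g : csub 1%g S (cong_capJ S S' g).
Proof. by move=> x /andP[]; rewrite conjg1. Qed.
Lemma csub_capr S S' g : csub g S' (cong_capJ S S' g).
Proof. by move=> x /andP[]. Qed.
Lemma csub_cap S S' S'' g :
  csub 1%g S S'' -> csub g S' S'' -> csub 1%g (cong_capJ S S' g) S''.
Proof.
move=> SS S'S x xS; rewrite conjg1; apply/andP; split; last exact: S'S.
by rewrite -[x]conjg1; apply: SS.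
Qed.
Lemma csub1l g S S' S'' : csub g S S' -> csub 1%g S' S'' -> csub g S S''.
Proof. by move=> p q; rewrite -[g]mul1g; apply: csub_trans q. Qed.
Lemma csub1r g S S' S'' : csub 1%g S S' -> csub g S' S'' -> csub g S S''.
Proof. by move=> p q; rewrite -[g]mulg1; apply: csub_trans q. Qed.

End Congruence.

Section Gmod.
Variables (R : fieldType) (G : groupType).

(** An [R[G]]-module: an [R]-vector space with a linear action of [G]. *)
Record gmod := Gmod {
  gmod_mod :> lmodType R;
  gact : G -> {linear gmod_mod -> gmod_mod};
  gact1 : forall v, gact 1%g v = v;
  gactM : forall g h v, gact (g * h)%g v = gact g (gact h v) }.

Record gmod_hom (V W : gmod) := GmodHom {
  gmod_hom_lin :> {linear V -> W};
  gmod_homP : forall g v, gmod_hom_lin (gact V g v) = gact W g (gmod_hom_lin v) }.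

Section TpowAct.
Variables (V W : gmod) (n : nat).
Definition tpow_act g : {linear tpow V n W -> tpow V n W} :=
  tpow_map (gact V g) (gact W g) n.
Fact tpow_act1 v : tpow_act 1%g v = v.
Proof.
rewrite /tpow_act; elim: n v => [|k IHk] v /=; first exact: gact1.
pose F := tens_map (gact V 1%g) (tpow_map (gact V 1%g) (gact W 1%g) k).
apply: (tens_ext (g := F) (h := idfun)) => m m'.
by rewrite /F tens_mapE gact1 IHk.
Qed.
Fact tpow_actM g h v : tpow_act (g * h)%g v = tpow_act g (tpow_act h v).
Proof.
rewrite /tpow_act; elim: n v => [|k IHk] v /=; first exact: gactM.
pose F x := tens_map (gact V x) (tpow_map (gact V x) (gact W x) k).
apply: (tens_ext (g := F (g * h)%g) (h := F g \o F h)) => m m'.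
change (F (g * h)%g (tens m m') = F g (F h (tens m m'))).
by rewrite /F !tens_mapE gactM IHk.
Qed.
Definition tpow_gmod : gmod := Gmod tpow_act1 tpow_actM.
End TpowAct.

End Gmod.

Section Smooth.
Variables (R : fieldType) (G : groupType) (Gamma : groupClosed G).

Definition smooth_vec (V : gmod R G) : {pred V} :=
  fun v => `[< exists S : cong Gamma, forall s, s \in S -> gact V s v = v >].
Arguments smooth_vec V v : clear implicits.

Definition smooth (V : gmod R G) : Prop := forall v : V, v \in smooth_vec V.

Section V.
Variable V : gmod R G.
Fact smooth_submod : submod_closed (smooth_vec V).
Proof.
split=> [|a v w /asboolP[S Sv] /asboolP[S' Sw]]; apply/asboolP.
  by exists (cong_top Gamma) => s _; rewrite linear0.
exists (cong_capJ S S' 1%g) => s /andP[sS]; rewrite conjg1 => sS'.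
by rewrite linearP Sv ?Sw.
Qed.
HB.instance Definition _ := GRing.isSubmodClosed.Build R V (smooth_vec V)
  (GRing.submod_closed_semi smooth_submod).

Fact smooth_act g v : v \in smooth_vec V -> gact V g v \in smooth_vec V.
Proof.
move=> /asboolP[S Sv]; apply/asboolP; exists (cong_capJ S S g) => s /andP[_ sS].
by rewrite -gactM conjgC gactM Sv.
Qed.

Definition Vinf_act g : {linear submod (smooth_vec V) -> submod (smooth_vec V)} :=
  sub_map (@smooth_act g).
Fact Vinf_act1 v : Vinf_act 1%g v = v.
Proof. by apply: val_inj; rewrite /= gact1. Qed.
Fact Vinf_actM g h v : Vinf_act (g * h)%g v = Vinf_act g (Vinf_act h v).
Proof. by apply: val_inj; rewrite /= gactM. Qed.
Definition Vinf : gmod R G := Gmod Vinf_act1 Vinf_actM.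
End V.

Section Map.
Variables (V W : gmod R G) (f : gmod_hom V W).
Fact Vinf_map_subproof v : v \in smooth_vec V -> f v \in smooth_vec W.
Proof.
move=> /asboolP[S Sv]; apply/asboolP; exists S => s sS.
by rewrite -gmod_homP Sv.
Qed.
Definition Vinf_map : {linear Vinf V -> Vinf W} := sub_map Vinf_map_subproof.
End Map.
End Smooth.
Arguments smooth_vec {R G} Gamma V v.

Section Dirlim.
Variables (R : fieldType) (G : groupType) (Gamma : groupClosed G).
Local Notation cong := (cong Gamma).

(** A family of [R]-modules [X S] with maps [X S -> X S'] for every [g] with
    [S'] contained in [g S g^-1], namely transport by [g] to [g S g^-1]
    followed by restriction to [S'].  The restriction maps proper are those
    with [g = 1]. *)
Record csys := CSys {
  csys_mod :> cong -> lmodType R;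
  csys_tr : forall g S S', csub g S S' -> {linear csys_mod S -> csys_mod S'};
  csys_id : forall S (p : csub 1%g S S) x, csys_tr p x = x;
  csys_comp : forall g h S S' S'' (p : csub h S S') (q : csub g S' S'')
    (r : csub (g * h)%g S S'') x, csys_tr q (csys_tr p x) = csys_tr r x }.

Section Lim.
Variable X : csys.
Local Notation tr := (@csys_tr X _ _ _).

Lemma csys_irr g S S' (p q : csub g S S') : tr p = tr q.
Proof. by rewrite (Prop_irrelevance p q). Qed.

Lemma csys_comp_eq k g h S S' S'' (p : csub h S S') (q : csub g S' S'')
  (r : csub k S S'') x : k = (g * h)%g -> tr q (tr p x) = tr r x.
Proof. by move=> kE; move: r; rewrite kE => r; apply: csys_comp. Qed.

Lemma csys_compl g S S' S'' (p : csub g S S') (q : csub 1%g S' S'')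
  (r : csub g S S'') x : tr q (tr p x) = tr r x.
Proof. by apply: csys_comp_eq; rewrite mul1g. Qed.

Lemma csys_compr g S S' S'' (p : csub 1%g S S') (q : csub g S' S'')
  (r : csub g S S'') x : tr q (tr p x) = tr r x.
Proof. by apply: csys_comp_eq; rewrite mulg1. Qed.

Record germ := Germ { germ_at : cong; germ_val : X germ_at }.
HB.instance Definition _ := gen_eqMixin germ.
HB.instance Definition _ := gen_choiceMixin germ.

Definition germ_eqv : rel germ := fun a b =>
  `[< exists S (p : csub 1%g (germ_at a) S) (q : csub 1%g (germ_at b) S),
        tr p (germ_val a) = tr q (germ_val b) >].

Fact germ_eqv_refl : reflexive germ_eqv.
Proof.
move=> a; apply/asboolP; exists (germ_at a).
by exists (@csub_refl _ _ _), (@csub_refl _ _ _).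
Qed.
Fact germ_eqv_sym : symmetric germ_eqv.
Proof.
by move=> a b; apply/asboolP/asboolP => -[S [p [q e]]]; exists S, q, p.
Qed.
Fact germ_eqv_trans : transitive germ_eqv.
Proof.
move=> b a c /asboolP[S [p [q e]]] /asboolP[S' [p' [q' e']]]; apply/asboolP.
pose T := cong_capJ S S' 1%g.
have l : csub 1%g S T := @csub_capl _ _ _ _ _.
have r : csub 1%g S' T := @csub_capr _ _ _ _ _.
exists T, (csub1l p l), (csub1l q' r).
rewrite -(csys_compl p l) e (csys_compl _ _ (csub1l q l)).
rewrite -(csys_compl q' r) -e' (csys_compl _ _ (csub1l p' r)).
by rewrite (csys_irr (csub1l q l) (csub1l p' r)).
Qed.
Canonical germ_equiv := EquivRel germ_eqv germ_eqv_refl germ_eqv_sym germ_eqv_trans.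
Canonical germ_encModRel := defaultEncModRel germ_eqv.

Definition dirlim_type : Type := {eq_quot germ_eqv}.
HB.instance Definition _ : EqQuotient germ germ_eqv dirlim_type :=
  EqQuotient.on dirlim_type.
HB.instance Definition _ := Choice.on dirlim_type.

Definition dirlim_fun S (x : X S) : dirlim_type := \pi_dirlim_type (Germ x).

Lemma dirlim_fun_eq S S' (x : X S) (y : X S') : dirlim_fun x = dirlim_fun y <->
  exists T (p : csub 1%g S T) (q : csub 1%g S' T), tr p x = tr q y.
Proof.
rewrite /dirlim_fun; split=> [/eqmodP/asboolP //|H].
by apply/eqmodP/asboolP.
Qed.

Lemma dirlim_fun_tr S S' (p : csub 1%g S S') x : dirlim_fun (tr p x) = dirlim_fun x.
Proof.
apply/dirlim_fun_eq; exists S', (@csub_refl _ _ _), p.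
by rewrite csys_id.
Qed.

Lemma dirlim_ind (z : dirlim_type) : exists S (x : X S), z = dirlim_fun x.
Proof.
by exists (germ_at (repr z)), (germ_val (repr z)); rewrite /dirlim_fun;
   case: (repr z) (reprK z).
Qed.

Lemma dirlim_ind2 (z t : dirlim_type) :
  exists S (x y : X S), z = dirlim_fun x /\ t = dirlim_fun y.
Proof.
have [S [x ->]] := dirlim_ind z; have [S' [y ->]] := dirlim_ind t.
exists (cong_capJ S S' 1%g), (tr (@csub_capl _ _ _ _ _) x), (tr (@csub_capr _ _ _ _ _) y).
by rewrite !dirlim_fun_tr.
Qed.

Lemma dirlim_ind3 (z t u : dirlim_type) : exists S (x y w : X S),
  [/\ z = dirlim_fun x, t = dirlim_fun y & u = dirlim_fun w].
Proof.
have [S [x [y [-> ->]]]] := dirlim_ind2 z t; have [S' [w ->]] := dirlim_ind u.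
exists (cong_capJ S S' 1%g), (tr (@csub_capl _ _ _ _ _) x),
  (tr (@csub_capl _ _ _ _ _) y), (tr (@csub_capr _ _ _ _ _) w).
by rewrite !dirlim_fun_tr.
Qed.

Lemma dirlim_repr S (x : X S) : exists T (p : csub 1%g (germ_at (repr (dirlim_fun x))) T)
  (q : csub 1%g S T), tr p (germ_val (repr (dirlim_fun x))) = tr q x.
Proof.
apply/dirlim_fun_eq; rewrite {1}/dirlim_fun.
by case: (repr (dirlim_fun x)) (reprK (dirlim_fun x)).
Qed.

Definition dirlim_add (z t : dirlim_type) : dirlim_type :=
  let a := repr z in let b := repr t in
  dirlim_fun (tr (@csub_capl _ _ (germ_at a) (germ_at b) 1%g) (germ_val a) +
              tr (@csub_capr _ _ (germ_at a) (germ_at b) 1%g) (germ_val b)).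
Definition dirlim_opp (z : dirlim_type) : dirlim_type :=
  dirlim_fun (- germ_val (repr z)).
Definition dirlim_scale a (z : dirlim_type) : dirlim_type :=
  dirlim_fun (a *: germ_val (repr z)).
Definition dirlim_zero : dirlim_type := dirlim_fun (0 : X (cong_top Gamma)).

Lemma dirlim_addE S (x y : X S) :
  dirlim_add (dirlim_fun x) (dirlim_fun y) = dirlim_fun (x + y).
Proof.
rewrite /dirlim_add.
have [T [p [q e]]] := dirlim_repr x; have [T' [p' [q' e']]] := dirlim_repr y.
set a := repr _ in p e *; set b := repr _ in p' e' *.
pose U := cong_capJ T T' 1%g.
have l : csub 1%g T U := @csub_capl _ _ _ _ _.
have r : csub 1%g T' U := @csub_capr _ _ _ _ _.
apply/dirlim_fun_eq.
exists U, (csub_cap (csub1l p l) (csub1l p' r)), (csub1l q l).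
rewrite !linearD (csys_compl _ _ (csub1l p l)) (csys_compl _ _ (csub1l p' r)).
rewrite -(csys_compl p l) -(csys_compl p' r) e e'; congr (_ + _).
  by rewrite (csys_compl _ _ (csub1l q l)).
by rewrite (csys_compl _ _ (csub1l q' r)) (csys_irr (csub1l q' r) (csub1l q l)).
Qed.

Lemma dirlim_oppE S (x : X S) : dirlim_opp (dirlim_fun x) = dirlim_fun (- x).
Proof.
have [T [p [q e]]] := dirlim_repr x.
by apply/dirlim_fun_eq; exists T, p, q; rewrite !linearN e.
Qed.

Lemma dirlim_scaleE a S (x : X S) : dirlim_scale a (dirlim_fun x) = dirlim_fun (a *: x).
Proof.
have [T [p [q e]]] := dirlim_repr x.
by apply/dirlim_fun_eq; exists T, p, q; rewrite !linearZ e.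
Qed.

Lemma dirlim_zeroE S : dirlim_zero = dirlim_fun (0 : X S).
Proof.
apply/dirlim_fun_eq; exists (cong_capJ (cong_top Gamma) S 1%g).
exists (@csub_capl _ _ _ _ _), (@csub_capr _ _ _ _ _).
by rewrite !linear0.
Qed.

Fact dirlim_addA : associative dirlim_add.
Proof.
move=> z t u; have [S [x [y [w [-> -> ->]]]]] := dirlim_ind3 z t u.
by rewrite !dirlim_addE addrA.
Qed.
Fact dirlim_addC : commutative dirlim_add.
Proof.
move=> z t; have [S [x [y [-> ->]]]] := dirlim_ind2 z t.
by rewrite !dirlim_addE addrC.
Qed.
Fact dirlim_add0 : left_id dirlim_zero dirlim_add.
Proof.
by move=> z; have [S [x ->]] := dirlim_ind z; rewrite (dirlim_zeroE S) dirlim_addE add0r.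
Qed.
Fact dirlim_addN : left_inverse dirlim_zero dirlim_opp dirlim_add.
Proof.
move=> z; have [S [x ->]] := dirlim_ind z.
by rewrite dirlim_oppE dirlim_addE addNr -dirlim_zeroE.
Qed.
HB.instance Definition _ := GRing.isZmodule.Build dirlim_type
  dirlim_addA dirlim_addC dirlim_add0 dirlim_addN.

Lemma dirlim_funD S (x y : X S) : dirlim_fun (x + y) = dirlim_fun x + dirlim_fun y.
Proof. by rewrite -dirlim_addE. Qed.

Fact dirlim_scaleA a b z : dirlim_scale a (dirlim_scale b z) = dirlim_scale (a * b) z.
Proof. by have [S [x ->]] := dirlim_ind z; rewrite !dirlim_scaleE scalerA. Qed.
Fact dirlim_scale1 : left_id 1 dirlim_scale.
Proof. by move=> z; have [S [x ->]] := dirlim_ind z; rewrite dirlim_scaleE scale1r. Qed.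
Fact dirlim_scaleDr : right_distributive dirlim_scale +%R.
Proof.
move=> a z t; have [S [x [y [-> ->]]]] := dirlim_ind2 z t.
by rewrite -dirlim_funD !dirlim_scaleE -dirlim_funD scalerDr.
Qed.
Fact dirlim_scaleDl z : {morph dirlim_scale^~ z : a b / a + b}.
Proof.
move=> a b; have [S [x ->]] := dirlim_ind z.
by rewrite !dirlim_scaleE -dirlim_funD scalerDl.
Qed.
HB.instance Definition _ := GRing.Zmodule_isLmodule.Build R dirlim_type
  dirlim_scaleA dirlim_scale1 dirlim_scaleDr dirlim_scaleDl.

Fact dirlim_fun_linear S : linear (@dirlim_fun S).
Proof. by move=> a x y; rewrite dirlim_funD -dirlim_scaleE. Qed.
Definition dirlim_in S : {linear X S -> dirlim_type} := mk_linear (@dirlim_fun_linear S).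

(** [g] sends the class of [x] in [X S] to the class of its image in
    [X (S \cap g S g^-1)]. *)
Definition dirlim_act_fun g (z : dirlim_type) : dirlim_type :=
  let a := repr z in
  dirlim_in _ (tr (@csub_capr _ _ (germ_at a) (germ_at a) g) (germ_val a)).

Lemma dirlim_act_funE g S S' (p : csub g S S') (x : X S) :
  dirlim_act_fun g (dirlim_in S x) = dirlim_in S' (tr p x).
Proof.
rewrite /dirlim_act_fun /=; have [T [r [q e]]] := dirlim_repr x.
set a := repr _ in r e *.
pose U := cong_capJ (cong_capJ (germ_at a) (germ_at a) g)
   (cong_capJ S' (cong_capJ S' T g) 1%g) 1%g.
have l : csub 1%g (cong_capJ (germ_at a) (germ_at a) g) U := @csub_capl _ _ _ _ _.
have k : csub 1%g S' U := csub1l (@csub_capl _ _ _ _ _) (@csub_capr _ _ _ _ _).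
have j : csub g T U.
  apply: (csub1l (@csub_capr _ _ _ _ _)).
  exact: (csub1l (@csub_capr _ _ _ _ _) (@csub_capr _ _ _ _ _)).
apply/dirlim_fun_eq; exists U, l, k.
rewrite (csys_compl _ _ (csub1r r j)) (csys_compl _ _ (csub1r q j)).
by rewrite -(csys_compr r j) -(csys_compr q j) e.
Qed.

Fact dirlim_act_linear g : linear (dirlim_act_fun g).
Proof.
move=> a z t; have [S [x [y [-> ->]]]] := dirlim_ind2 z t.
have E (u : X S) : dirlim_act_fun g (dirlim_fun u) = _ :=
  dirlim_act_funE (@csub_capr _ _ S S g) u.
by rewrite -(dirlim_fun_linear a x y) !E !linearP.
Qed.
Definition dirlim_act g : {linear dirlim_type -> dirlim_type} :=
  mk_linear (@dirlim_act_linear g).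

Fact dirlim_act1 z : dirlim_act 1%g z = z.
Proof.
have [S [x ->]] := dirlim_ind z.
by rewrite /= (dirlim_act_funE (@csub_refl _ _ S)) csys_id.
Qed.
Fact dirlim_actM g h z : dirlim_act (g * h)%g z = dirlim_act g (dirlim_act h z).
Proof.
have [S [x ->]] := dirlim_ind z; rewrite /=.
have p := @csub_capr _ _ S S h; set S' := cong_capJ _ _ _ in p.
have q := @csub_capr _ _ S' S' g.
by rewrite (dirlim_act_funE p) (dirlim_act_funE q) (dirlim_act_funE (csub_trans p q))
   (csys_comp _ _ (csub_trans p q)).
Qed.

Definition dirlim : gmod R G := Gmod dirlim_act1 dirlim_actM.

End Lim.

Record csys_hom (X Y : csys) := CSysHom {
  csys_hom_lin :> forall S, {linear X S -> Y S};
  csys_homP : forall g S S' (p : csub g S S') x,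
    csys_hom_lin S' (csys_tr X p x) = csys_tr Y p (csys_hom_lin S x) }.

Section LimMap.
Variables (X Y : csys) (f : csys_hom X Y).
Definition dirlim_map_fun (z : dirlim X) : dirlim Y :=
  dirlim_in Y _ (f _ (germ_val (repr z))).
Lemma dirlim_map_funE S x : dirlim_map_fun (dirlim_in X S x) = dirlim_in Y S (f S x).
Proof.
have [T [p [q e]]] := dirlim_repr x.
apply/dirlim_fun_eq; exists T, p, q.
by rewrite -!csys_homP e.
Qed.
Fact dirlim_map_linear : linear dirlim_map_fun.
Proof.
move=> a z t; have [S [x [y [-> ->]]]] := dirlim_ind2 z t.
have E (u : X S) : dirlim_map_fun (dirlim_fun u) = _ := dirlim_map_funE u.
by rewrite -(dirlim_fun_linear a x y) !E !linearP.
Qed.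
Definition dirlim_map : {linear dirlim X -> dirlim Y} := mk_linear dirlim_map_linear.
End LimMap.
End Dirlim.

Section GroupRing.
Variables (R : fieldType) (G : groupType).
Local Notation RG := {freeg G / R}.

Definition gr_mul (a b : RG) : RG :=
  free_lift (fun g => free_lift (fun h => << (g * h)%g >> : RG) b) a.

Definition augmentation (a : RG) : R := free_lift (fun=> 1 : R^o) a.

Definition gr_act (V : gmod R G) (a : RG) (v : V) : V :=
  free_lift (fun g => gact V g v) a.

Section Sub.
Variable S : groupClosed G.

(** For a subgroup [S], the group ring [R[S]] is the set of elements of [R[G]]
    supported in [S]. *)
Definition group_ring : {pred RG} := fun a => all (mem S) (dom a).

Definition aug_ideal : {pred RG} := fun a => (a \in group_ring) && (augmentation a == 0).

(** The powers of the augmentation ideal of [R[S]]. *)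
Fixpoint aug_pow n : {pred RG} :=
  if n is n'.+1 then
    span [set gr_mul a b | a in [set` aug_pow n'] & b in [set` aug_ideal]]
  else group_ring.

Variable V : gmod R G.

Lemma gr_actU g v : gr_act (V := V) << g >> v = gact V g v.
Proof. exact: free_liftU. Qed.

Lemma gr_actE a (v : V) : gr_act a v = \sum_(g <- dom a) coeff g a *: gact V g v.
Proof.
rewrite /gr_act -[a in LHS]freeg_sumE linear_sum; apply: eq_bigr => g _.
have -> : << coeff g a *g g >> = coeff g a *: << g >> :> RG.
  by apply/eqP/freeg_eqP => y; rewrite coeffZ !coeffU mul1r.
by rewrite linearZ; congr (_ *: _); exact: free_liftU.
Qed.

Lemma augmentationE a : augmentation a = \sum_(g <- dom a) coeff g a.
Proof.
rewrite /augmentation -[a in LHS]freeg_sumE linear_sum; apply: eq_bigr => g _.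
have -> : << coeff g a *g g >> = coeff g a *: << g >> :> RG.
  by apply/eqP/freeg_eqP => y; rewrite coeffZ !coeffU mul1r.
by rewrite linearZ free_liftU; exact: mulr1.
Qed.

Lemma gr_act_linear a : linear (@gr_act V a).
Proof.
move=> c v w; rewrite !gr_actE scaler_sumr -big_split; apply: eq_bigr => g _.
by rewrite linearP scalerDr !scalerA mulrC.
Qed.

Lemma gr_actM a b (v : V) : gr_act (gr_mul a b) v = gr_act a (gr_act b v).
Proof.
pose L (w : V) := free_lift (fun g => gact V g w).
pose M c := free_lift (fun g => free_lift (fun h => << (g * h)%g >> : RG) c).
apply: (free_ext (g := L v \o M b) (h := L (gr_act b v))) => g.
change (gr_act (M b << g >>) v = gr_act << g >> (gr_act b v)).
rewrite gr_actU /M free_liftU.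
pose N := free_lift (fun h => << (g * h)%g >> : RG).
apply: (free_ext (g := L v \o N) (h := gact V g \o L v)) => h.
change (gr_act (N << h >>) v = gact V g (gr_act << h >> v)).
by rewrite /N free_liftU !gr_actU gactM.
Qed.

(** An elementwise form of [aug_pow S n * v = 0]. *)
Fixpoint unip n (v : V) : Prop :=
  if n is n'.+1 then forall s, s \in S -> unip n' (gact V s v - v) else v = 0.

Lemma unip0 n : unip n 0.
Proof. by elim: n => //= n IHn s _; rewrite linear0 subr0. Qed.
Lemma unipP n a v w : unip n v -> unip n w -> unip n (a *: v + w).
Proof.
elim: n v w => [|n IHn] v w /=; first by move=> -> ->; rewrite scaler0 addr0.
move=> Hv Hw s sS.
rewrite linearP opprD addrACA -scalerBr; apply: IHn; [exact: Hv | exact: Hw].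
Qed.
Lemma unip_sum n (I : Type) (r : seq I) (F : I -> V) :
  (forall i, unip n (F i)) -> unip n (\sum_(i <- r) F i).
Proof.
move=> FP; elim/big_rec: _ => [|i x _ Hx]; first exact: unip0.
by rewrite -[F i]scale1r; apply: unipP.
Qed.

Lemma aug_powP n v : (forall a, a \in aug_pow n -> gr_act a v = 0) <-> unip n v.
Proof.
elim: n v => [|n IHn] v /=.
  split=> [H|-> a _]; last first.
    by rewrite gr_actE big1 // => g _; rewrite linear0 scaler0.
  rewrite -(gact1 v) -gr_actU; apply: H.
  by rewrite unfold_in /group_ring domU1 /= gpred1.
split=> [H s sS|H].
  apply/IHn => a aI.
  have bI : (<< s >> - << 1%g >> : RG) \in aug_ideal.
    rewrite unfold_in; apply/andP; split; last first.
      by rewrite /augmentation linearB !free_liftU subrr.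
    apply/allP => x xd; have := domB xd; rewrite mem_cat !domU1 !mem_seq1.
    by case/orP => /eqP -> //=; exact: gpred1.
  rewrite -{2}(gact1 v) -!gr_actU.
  have -> : gr_act << s >> v - gr_act << 1%g >> v = gr_act (<< s >> - << 1%g >>) v.
    by rewrite /gr_act linearB.
  by rewrite -gr_actM; apply: H; apply: mem_span; exists a => //; exists (<< s >> - << 1%g >>).
move=> x; apply: (span_ker (f := free_lift (fun g => gact V g v))).
move=> _ [a aI [b bI <-]].
change (gr_act (gr_mul a b) v = 0); rewrite gr_actM.
move: a aI; apply/IHn; move: bI => /= /andP[/allP bS /eqP b0].
have -> : gr_act b v = \sum_(g <- dom b | g \in S) coeff g b *: (gact V g v - v).
  rewrite big_seq_cond (eq_bigl (fun g => g \in dom b)); last first.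
    by move=> g; case: (boolP (g \in dom b)) => //= /bS.
  rewrite -big_seq gr_actE.
  under [RHS]eq_bigr do rewrite scalerBr.
  by rewrite sumrB -scaler_suml -augmentationE b0 scale0r subr0.
elim/big_rec: _ => [|g y gS]; first exact: unip0.
by apply: unipP; apply: H.
Qed.

End Sub.
End GroupRing.

Section HigherInv.
Variables (R : fieldType) (G : groupType) (P : {pred G}) (V : gmod R G).

(** [H0 P V S q] is H^0_q(S, P \cap S, V). *)
Definition H0 (S : groupClosed G) (q : nat) : {pred V} := fun v =>
  if q is 0 then v == 0 else
  `[< (forall a, a \in aug_pow S q -> gr_act a v = 0) /\
      (forall p, p \in P -> p \in S -> gact V p v = v) >].
Arguments H0 S q v : clear implicits.

Lemma H0P S q v : v \in H0 S q <->
  unip S q v /\ (forall p, p \in P -> p \in S -> gact V p v = v).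
Proof.
rewrite unfold_in /H0; case: q => [|q].
  by split=> [/eqP -> | [/= -> _] //]; split=> // p _ _; rewrite linear0.
by split=> [/asboolP[/aug_powP]|[/aug_powP H H']] //; apply/asboolP.
Qed.

Fact H0_submod S q : submod_closed (H0 S q).
Proof.
split=> [|a v w /H0P[v1 v2] /H0P[w1 w2]]; apply/H0P; split.
- exact: unip0.
- by move=> p _ _; rewrite linear0.
- exact: unipP.
- by move=> p pP pS; rewrite linearP v2 ?w2.
Qed.
HB.instance Definition _ S q := GRing.isSubmodClosed.Build R V (H0 S q)
  (GRing.submod_closed_semi (H0_submod S q)).

Definition Hbar (S : groupClosed G) (q : nat) : lmodType R :=
  subq (H0 S q) (H0 S q.-1).

Definition Hbar_class S q v (Hv : v \in H0 S q) : Hbar S q :=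
  subq_class (H0 S q.-1) Hv.

Lemma Hbar_ind S q (z : Hbar S q) : exists v (Hv : v \in H0 S q), z = Hbar_class Hv.
Proof. exact: subq_ind. Qed.

Lemma Hbar_classD S q v w (Hv : v \in H0 S q) (Hw : w \in H0 S q) :
  Hbar_class (rpredD Hv Hw) = Hbar_class Hv + Hbar_class Hw.
Proof. by rewrite -linearD; congr quot_pi; apply: val_inj; rewrite raddfD. Qed.

Lemma Hbar_class_eq S q v w (Hv : v \in H0 S q) (Hw : w \in H0 S q) :
  Hbar_class Hv = Hbar_class Hw <-> v - w \in H0 S q.-1.
Proof. exact: subq_class_eq. Qed.

End HigherInv.
Arguments H0 {R G} P V S q v.
Arguments Hbar {R G} P V S q.

Section Systems.
Variables (R : fieldType) (G : groupType) (Gamma : groupClosed G).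
Variables (P : {pred G}) (hP : conj_invariant P).
Local Notation cong := (cong Gamma).

Section HbarSys.
Variable V : gmod R G.

Lemma H0_act g (S S' : cong) q : csub g S S' ->
  forall v, v \in H0 P V S q -> gact V g v \in H0 P V S' q.
Proof.
move=> gS v /H0P[v1 v2]; apply/H0P; split.
  elim: q v v1 {v2} => [|q IHq] v /=; first by move=> ->; rewrite linear0.
  move=> vS s sS.
  by rewrite -gactM conjgC gactM -linearB; apply: IHq; apply: vS; apply: gS.
move=> p pP pS; rewrite -gactM conjgC gactM v2 //; last exact: gS.
exact: hP.
Qed.

Section Tr.
Variables (q : nat) (g : G) (S S' : cong) (p : csub g S S').
Definition Hbar_tr : {linear Hbar P V S q -> Hbar P V S' q} :=
  subq_map (H0_act p) (H0_act p).
Lemma Hbar_trE v (Hv : v \in H0 P V S q) :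
  Hbar_tr (Hbar_class Hv) = Hbar_class (H0_act p Hv).
Proof. exact: subq_mapE. Qed.
End Tr.

Variable q : nat.

Fact Hbar_tr_id (S : cong) (p : csub 1%g S S) x : Hbar_tr q p x = x.
Proof.
have [v [Hv ->]] := Hbar_ind x; rewrite Hbar_trE.
by apply/Hbar_class_eq; rewrite gact1 subrr rpred0.
Qed.
Fact Hbar_tr_comp g h (S S' S'' : cong) (p : csub h S S') (r : csub g S' S'')
  (t : csub (g * h)%g S S'') x : Hbar_tr q r (Hbar_tr q p x) = Hbar_tr q t x.
Proof.
have [v [Hv ->]] := Hbar_ind x; rewrite !Hbar_trE.
by apply/Hbar_class_eq; rewrite gactM subrr rpred0.
Qed.
Definition Hbar_sys : csys R Gamma := CSys Hbar_tr_id Hbar_tr_comp.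

(** L_q(P, V) *)
Definition Lmod : gmod R G := dirlim Hbar_sys.

End HbarSys.

Section HbarMap.
Variables (V W : gmod R G) (f : gmod_hom V W) (q : nat).

Lemma H0_map S k v : v \in H0 P V S k -> f v \in H0 P W S k.
Proof.
move=> /H0P[v1 v2]; apply/H0P; split=> [|p pP pS]; last by rewrite -gmod_homP v2.
elim: k v v1 {v2} => [|k IHk] v /=; first by move=> ->; rewrite linear0.
by move=> vS s sS; rewrite -gmod_homP -linearB; apply: IHk; apply: vS.
Qed.

Definition Hbar_map S : {linear Hbar P V S q -> Hbar P W S q} :=
  subq_map (@H0_map S q) (@H0_map S q.-1).

Fact Hbar_map_tr g (S S' : cong) (p : csub g S S') x :
  Hbar_map S' (csys_tr (Hbar_sys V q) p x) = csys_tr (Hbar_sys W q) p (Hbar_map S x).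
Proof.
have [v [Hv ->]] := Hbar_ind x.
rewrite [csys_tr _ _ _]Hbar_trE [Hbar_map S _]subq_mapE.
rewrite [LHS]subq_mapE [RHS]Hbar_trE.
by apply/Hbar_class_eq; rewrite gmod_homP subrr rpred0.
Qed.
Definition Hbar_sys_hom : csys_hom (Hbar_sys V q) (Hbar_sys W q) :=
  @CSysHom _ _ _ (Hbar_sys V q) (Hbar_sys W q) Hbar_map Hbar_map_tr.

Definition Lmod_map : {linear Lmod V q -> Lmod W q} := dirlim_map Hbar_sys_hom.
End HbarMap.

Section HomP.
Variables (S : groupClosed G) (M : lmodType R).
Definition homP_pred : {pred subgrp S -> M} := fun f =>
  `[< (forall x y : subgrp S, f (x * y)%g = f x + f y) /\
      (forall x : subgrp S, val x \in P -> f x = 0) >].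
Arguments homP_pred f : clear implicits.
Fact homP_submod : submod_closed homP_pred.
Proof.
split=> [|a f h /asboolP[f1 f2] /asboolP[h1 h2]]; apply/asboolP.
  by split=> // x y; exact/esym/addr0.
have E x : (a *: f + h) x = a *: f x + h x by [].
split=> [x y|x xP]; rewrite !E; first by rewrite f1 h1 scalerDr addrACA.
by rewrite f2 // h2 // scaler0 addr0.
Qed.
HB.instance Definition _ := GRing.isSubmodClosed.Build R (subgrp S -> M) homP_pred
  (GRing.submod_closed_semi homP_submod).
Definition homP : lmodType R := submod homP_pred.
Definition homP_fun (f : homP) : subgrp S -> M := val f.
End HomP.
Arguments homP_pred S M f : clear implicits.

Definition homPR (S : groupClosed G) : lmodType R := homP S (R^o : lmodType R).

Section HomTr.
Variables (g : G) (S S' : cong) (p : csub g S S').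
(** [f : Hom_P(S, R)] is sent to [x |-> f (g^-1 x g)] on [S']. *)
Definition conj_elt (x : subgrp S') : subgrp S := Subgrp (p (subgrp_valP x)).
Definition hom_comp (f : subgrp S -> R^o) : subgrp S' -> R^o := f \o conj_elt.
Fact hom_comp_linear : linear hom_comp. Proof. by []. Qed.
Fact hom_comp_sub f : f \in homP_pred S (R^o : lmodType R) ->
  mk_linear hom_comp_linear f \in homP_pred S' (R^o : lmodType R).
Proof.
move=> /asboolP[f1 f2]; apply/asboolP; split=> [x y|x xP] /=.
  rewrite /hom_comp /= -f1; congr f; apply: val_inj.
  by rewrite /= conjMg.
by apply: f2; apply: hP.
Qed.
Definition hom_tr : {linear homPR S -> homPR S'} := sub_map hom_comp_sub.
End HomTr.

Fact hom_tr_id (S : cong) (p : csub 1%g S S) x : hom_tr p x = x.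
Proof.
apply: val_inj; apply/funext => y /=; rewrite /hom_comp /=; congr (val x _).
by apply: val_inj; rewrite /= conjg1.
Qed.
Fact hom_tr_comp g h (S S' S'' : cong) (p : csub h S S') (r : csub g S' S'')
  (t : csub (g * h)%g S S'') x : hom_tr r (hom_tr p x) = hom_tr t x.
Proof.
apply: val_inj; apply/funext => y /=; rewrite /hom_comp /=; congr (val x _).
by apply: val_inj; rewrite /= conjgM.
Qed.
Definition hom_sys : csys R Gamma := CSys hom_tr_id hom_tr_comp.

Definition Homhat : gmod R G := dirlim hom_sys.

Section Canon.
Variables (S : groupClosed G) (M : lmodType R).
Definition hom_scale (h : homPR S) (m : M) : subgrp S -> M :=
  fun s => (homP_fun h s : R) *: m.
Fact hom_scale_sub h m : hom_scale h m \in homP_pred S M.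
Proof.
have /asboolP[h1 h2] := submod_valP h; apply/asboolP; split=> [x y|x xP].
  by rewrite -scalerDl; congr (_ *: _); apply: h1.
by rewrite /hom_scale [homP_fun h x]h2 // scale0r.
Qed.
Definition hom_tens_fun (h : homPR S) (m : M) : homP S M := Submod (hom_scale_sub h m).
Fact hom_tens_funl m : linear (hom_tens_fun^~ m).
Proof.
move=> a h h'; apply: val_inj; apply/funext => s.
by rewrite /= /hom_scale /homP_fun /= !fctE scalerDl scalerA.
Qed.
Fact hom_tens_funr h : linear (hom_tens_fun h).
Proof.
move=> a m m'; apply: val_inj; apply/funext => s.
by rewrite /= /hom_scale !fctE scalerDr !scalerA mulrC.
Qed.

(** [hom_tens (h (x) m) s = h s *: m] *)
Definition hom_tens : {linear tensor (homPR S) M -> homP S M} :=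
  tens_lift hom_tens_funl hom_tens_funr.
End Canon.

Section Lowering.
Variables (V : gmod R G) (S : cong).

Section Map.
Variable q : nat.

Lemma H0_lower s v : s \in S -> v \in H0 P V S q.+1 -> gact V s v - v \in H0 P V S q.
Proof.
move=> sS /H0P[/= v1 v2]; apply/H0P; split=> [|p pP pS]; first exact: v1.
rewrite linearB (v2 p) // -gactM conjgC gactM (v2 (p ^ s)%g) //; first exact: hP.
by rewrite conjgE !gpredM ?gpredV.
Qed.

Lemma H0_sub s v : s \in S -> v \in H0 P V S q -> gact V s v - v \in H0 P V S q.-1.
Proof.
case: q => [|k] sS /H0P[/= v1 v2].
  by rewrite v1 linear0 subr0 rpred0.
apply/H0P; split=> [|p pP pS]; first exact: v1.
rewrite linearB (v2 p) // -gactM conjgC gactM (v2 (p ^ s)%g) //; first exact: hP.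
by rewrite conjgE !gpredM ?gpredV.
Qed.

Definition lower_fun (v : submod (H0 P V S q.+1)) : subgrp S -> Hbar P V S q :=
  fun s => Hbar_class (H0_lower (subgrp_valP s) (submod_valP v)).

Fact lower_fun_sub v : lower_fun v \in homP_pred S (Hbar P V S q).
Proof.
case: v => v Hv; apply/asboolP; split=> [x y|x xP]; rewrite /lower_fun.
  rewrite -Hbar_classD; refine ((Hbar_class_eq _ _).2 _).
  have E (g h : G) : gact V (g * h)%g v - v - (gact V g v - v + (gact V h v - v)) =
      gact V g (gact V h v - v) - (gact V h v - v).
    by rewrite gactM linearB opprD addrA opprB addrA subrK.
  by rewrite /= E; apply: (H0_sub (subgrp_valP x) (H0_lower (subgrp_valP y) Hv)).
have [_ v2] := (H0P _ _ _ _).1 Hv.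
apply: quot_pi_eq0; rewrite unfold_in /=.
by rewrite v2 ?subrr ?rpred0 ?subgrp_valP.
Qed.

Definition lower_pre (v : submod (H0 P V S q.+1)) : homP S (Hbar P V S q) :=
  Submod (lower_fun_sub v).
Fact lower_pre_linear : linear lower_pre.
Proof.
move=> a v w; apply: val_inj; apply/funext => s; rewrite /= !fctE /lower_fun.
rewrite -linearP; congr quot_pi; apply: val_inj.
by rewrite /= (linearP (gact V _)) opprD addrACA scalerBr.
Qed.
Fact lower_subproof v (Hv : v \in H0 P V S q.+1) : v \in H0 P V S q ->
  mk_linear lower_pre_linear (Submod Hv) = 0.
Proof.
move=> vq; apply: val_inj; apply/funext => s.
by apply: quot_pi_eq0; apply: H0_sub (subgrp_valP s) vq.
Qed.

(** The class of [v] is sent to [s |-> (s - 1) v]. *)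
Definition lower : {linear Hbar P V S q.+1 -> homP S (Hbar P V S q)} :=
  subq_lift lower_subproof.
End Map.

(** [iter_lower q D] says that [D] is the composite of the maps
    H_q -> Hom_P(S, R) (x) H_{q-1} -> ... -> Hom_P(S, R)^{(x)(q-1)} (x) H_1,
    each arrow being [lower] followed by the inverse of [hom_tens]. *)
Inductive iter_lower : forall q : nat,
  {linear Hbar P V S q -> tpow (homPR S) q.-1 (Hbar P V S 1)} -> Prop :=
| IterLower1 (D : {linear Hbar P V S 1 -> Hbar P V S 1}) :
    D =1 id -> iter_lower (q := 1) D
| IterLowerS q (D : {linear Hbar P V S q.+1 -> tpow (homPR S) q (Hbar P V S 1)})
    (D' : {linear Hbar P V S q.+2 -> tpow (homPR S) q.+1 (Hbar P V S 1)}) :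
    iter_lower (q := q.+1) D ->
    (forall x, exists2 t : tensor (homPR S) (Hbar P V S q.+1),
       hom_tens S (Hbar P V S q.+1) t = lower q.+1 x & D' x = tens_map idfun D t) ->
    iter_lower (q := q.+2) D'.

Fact Hbar1_smooth v : v \in H0 P V S 1 -> v \in smooth_vec Gamma V.
Proof.
move=> /H0P[/= v1 _]; apply/asboolP; exists S => s sS.
by apply/eqP; rewrite -subr_eq0; apply/eqP; apply: v1.
Qed.
Fact Hbar1_subproof v (Hv : v \in H0 P V S 1) : v \in H0 P V S 0 ->
  sub_map (f := idfun) Hbar1_smooth (Submod Hv) = 0.
Proof. by move=> /eqP v0; apply: val_inj. Qed.

(** H_1(S, P, V) -> V^oo, the class of [v] being sent to [v]. *)
Definition Hbar1_in : {linear Hbar P V S 1 -> Vinf Gamma V} :=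
  subq_lift Hbar1_subproof.
End Lowering.

(** Hom_P^{(x)(q-1)} (x) V^oo *)
Definition target (V : gmod R G) (q : nat) : gmod R G :=
  tpow_gmod Homhat (Vinf Gamma V) q.-1.

Definition target_map (V W : gmod R G) (f : gmod_hom V W) (q : nat) :
    {linear target V q -> target W q} :=
  tpow_map idfun (Vinf_map Gamma f) q.-1.

Definition target_in (V : gmod R G) (q : nat) (S : cong) :
    {linear tpow (homPR S) q.-1 (Hbar P V S 1) -> target V q} :=
  tpow_map (dirlim_in hom_sys S) (Hbar1_in V S) q.-1.

End Systems.

(* Main.v *)
Require Import Defs.
From HB Require Import structures.
From mathcomp Require Import ssreflect ssrfun ssrbool eqtype ssrnat seq choice.
From mathcomp Require Import monoid ssralg.
From mathcomp Require Import fintype bigop generic_quotient.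
From mathcomp Require Import boolp classical_sets functions cardinality.

(** Congruence subgroups have finite index in [Gamma], hence are finitely
    generated, so a finite family [b_i] in [S] with homomorphisms [h_i] satisfies
    [f s = \sum_i h_i s *: f b_i] for all homomorphisms [f] on [S] vanishing on
    [P]; this inverts [Hom_P(S, R) (x) M -> Hom_P(S, M)].  For injectivity the
    individual maps at level [S] do not suffice, because restriction of
    homomorphisms to a subgroup of finite index has a kernel in positive
    characteristic.  Instead, the lowered class of [x] is written as
    [\sum_i h_i (x) m_i] over a congruence subgroup chosen so that the number of
    terms is minimal among all congruence subgroups: the [h_i] are then
    independent in the direct limit, so if [x] is sent to 0 each [m_i] is sent
    to 0, hence vanishes on a smaller subgroup by induction on the degree, and
    there [x] is killed by the order-lowering map, which is injective. *)

Set Implicit Arguments.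
Unset Strict Implicit.
Unset Printing Implicit Defensive.

Import GRing.Theory.
Local Open Scope ring_scope.

(** * Finite generation of congruence subgroups *)

Section FiniteGeneration.
Local Open Scope group_scope.
Variable G : groupType.

Definition mk_group (A : {pred G}) (AG : group_closed A) : groupClosed G :=
  HB.pack A (isMulClosed.Build G A (group_closedM AG))
    (isMul1Closed.Build G A (proj1 AG)) (isInvClosed.Build G A (group_closedV AG)).

Lemma finite_image_reps (X : Type) (f : G -> X) (A : set G) :
  finite_set (f @` A)%classic ->
  exists2 T : seq G, forall t, t \in T -> A t &
    forall x, A x -> exists2 t, t \in T & f t = f x.
Proof.
move=> fin; have [s sE] : exists s : seq {classic X}, (f @` A)%classic = [set` s]%classic.
  exact/finite_seqP.
have /choice [r rP] : forall y : {classic X}, exists x,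
    (f @` A)%classic y -> A x /\ f x = y.
  move=> y; have [[x Ax <-]|ny] := pselect ((f @` A)%classic y); last by exists 1.
  by exists x.
have im y : y \in s -> (f @` A)%classic y by rewrite sE.
exists [seq r y | y <- s] => [t /mapP[y /im ys ->]|x Ax]; first by case: (rP y ys).
have fx : (f @` A)%classic (f x) by exists x.
exists (r (f x)); last by case: (rP _ fx).
by apply: map_f; rewrite sE in fx.
Qed.

Definition finite_index (H K : {pred G}) : Prop :=
  exists2 T : seq G, {subset T <= H} &
    forall x, x \in H -> exists2 t, t \in T & t^-1 * x \in K.

(** Send [x] to the tuple of cosets [x g Gamma], [g] in [s]. Each double coset holds finitely many
    cosets, so there are finitely many tuples; equal tuples for [x] and [t] put [t^-1 x] in every
    [g Gamma g^-1]. *)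
Lemma congruence_finite_index (Gamma : groupClosed G) (S : cong Gamma) :
  hecke_pair Gamma -> finite_index Gamma S.
Proof.
move=> hecke; have [_ [s sS]] := congP S.
pose f x := [seq left_coset Gamma (x * g) | g <- s].
have fin : finite_set (f @` [set` Gamma])%classic.
  rewrite /f; elim: s {sS f} => [|g s IHs] /=.
    by apply: (@sub_finite_set _ _ [set [::]]%classic) => // _ [x _ <-].
  apply: (finite_image11 cons _ IHs).
  apply: sub_finite_set (hecke g) => _ [x xG <-].
  exists (x * g) => //; exists x => //; exists 1; last by rewrite mulg1.
  exact: gpred1.
have [T TG TP] := finite_image_reps fin; exists T => // x xG.
have [t tT ft] := TP x xG; exists t => //; have tG := TG t tT.
apply: sS => [|g gs]; first by rewrite gpredM ?gpredV.
have : left_coset Gamma (x * g) (x * g) by exists 1; rewrite ?mulg1 //; exact: gpred1.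
have -> : left_coset Gamma (x * g) = left_coset Gamma (t * g).
  have := congr1 (nth set0 ^~ (index g s)) ft.
  by rewrite !(nth_map g) ?index_mem // nth_index.
case=> h hG E.
have -> : x = t * g * h * g^-1 by rewrite E mulgK.
by rewrite -!mulgA mulKg conjgE -!mulgA mulVg mulg1 mulKg.
Qed.

(** Schreier's argument: the elements [t^-1 a t'] lying in [S], for [t], [t']
    coset representatives and [a] a generator or its inverse, together with
    the representatives lying in [S], generate [S]. *)
Lemma finite_index_fg (H S : groupClosed G) :
  {subset S <= H} -> finite_index H S -> finitely_generated H -> finitely_generated S.
Proof.
move=> SH [T TH TP] [l lH lgen].
pose l' := l ++ [seq x^-1 | x <- l].
pose gens := T ++ [seq t^-1 * y | t <- T, y <- [seq a * t' | a <- l', t' <- T]].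
exists [seq x <- gens | x \in S] => [x|K genK]; first by rewrite mem_filter => /andP[].
have gK x : x \in gens -> x \in S -> x \in K.
  by move=> xg xS; apply: genK; rewrite mem_filter xS.
have TK t : t \in T -> t \in S -> t \in K.
  by move=> tT; apply: gK; rewrite mem_cat tT.
(* [TKS] is the product set [T (K \cap S)]. It is stable under left multiplication by a generator
   [a], as [a t = t' (t'^-1 a t)] with the bracket among the Schreier elements. *)
pose TKS x := exists t, [/\ t \in T, t^-1 * x \in K & t^-1 * x \in S].
have lTKS a x : a \in l' -> TKS x -> TKS (a * x).
  move=> al [t [tT tK tS]].
  have aH : a \in H.
    move: al; rewrite mem_cat => /orP[/lH //|/mapP[b /lH bH ->]].
    by rewrite gpredV.
  have atH : a * t \in H by rewrite gpredM // TH.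
  have [t' t'T t'S] := TP _ atH.
  exists t'.
  have -> : t'^-1 * (a * x) = (t'^-1 * (a * t)) * (t^-1 * x).
    by rewrite !mulgA mulgK.
  split=> //; rewrite gpredM //; apply: gK => //.
  rewrite mem_cat; apply/orP; right; apply: allpairs_f => //.
  exact: allpairs_f.
pose stab : {pred G} := fun g => `[< forall x, TKS x -> TKS (g * x) /\ TKS (g^-1 * x) >].
have stabG : group_closed stab.
  split=> [|g h /asboolP gP /asboolP hP]; apply/asboolP => x.
    by rewrite invg1 !mul1g.
  move=> xP; rewrite invgM invgK -!mulgA; split.
    by apply: (gP _ _).1; apply: (hP _ _).2.
  by apply: (hP _ _).1; apply: (gP _ _).2.
have Hstab : {subset H <= mk_group stabG}.
  apply: lgen => a al; apply/asboolP => x xP; split; apply: lTKS => //.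
    by rewrite mem_cat al.
  by rewrite mem_cat map_f ?orbT.
have TKS1 : TKS 1.
  have [t tT] := TP 1 gpred1; rewrite mulg1 gpredV => tS.
  by exists t; rewrite mulg1 !gpredV TK.
(* Stability carries [1] to [s], so [s = t (t^-1 s)] with [t^-1 s] in [K \cap S]; then [t] lies in
   [S], hence in [K]. *)
move=> s sS; have /asboolP/(_ 1 TKS1) [] := Hstab s (SH s sS).
rewrite mulg1 => -[t [tT tK tS]] _.
move: tS; rewrite gpredMr // gpredV => tS.
by rewrite -(mulVKg t s) gpredM // TK.
Qed.

Lemma cong_fg (Gamma : groupClosed G) (S : cong Gamma) :
  hecke_pair Gamma -> finitely_generated Gamma -> finitely_generated S.
Proof.
move=> hecke; apply: finite_index_fg; last exact: congruence_finite_index.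
exact: (congP S).1.
Qed.

End FiniteGeneration.

(** * Vector spaces and tensor products *)

Section LinearAlgebra.
Variable R : fieldType.

(** Subtracting [e j / d j] times the relation kills the coefficient at [j]. *)
Lemma sum_eliminate (M : lmodType R) n (d : 'I_n.+1 -> R) (j : 'I_n.+1)
    (m : 'I_n.+1 -> M) :
  \sum_i d i *: m i = 0 -> d j != 0 -> forall e : 'I_n.+1 -> R,
  \sum_i e i *: m i =
  \sum_(i < n) (e (lift j i) - d (lift j i) / d j * e j) *: m (lift j i).
Proof.
move=> dm dj e.
have -> : \sum_i e i *: m i = \sum_i (e i - d i / d j * e j) *: m i.
  under [RHS]eq_bigr do rewrite scalerBl mulrAC -mulrA mulrC -scalerA.
  by rewrite sumrB -scaler_sumr dm scaler0 subr0.
by rewrite (bigD1_ord j) //= mulfV // mul1r subrr scale0r add0r.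
Qed.

(** Zorn's lemma gives a maximal subspace [A] containing [W] but not [v]. Maximality forces every
    vector into [A + R v], and [l] is the coordinate along [v]. *)
Lemma separating_functional (M : lmodType R) (W : submodClosed M) (v : M) :
  v \notin W -> exists l : {linear M -> R^o}, l v = 1 /\ forall w, w \in W -> l w = 0.
Proof.
move=> vW.
pose P (A : set M) := A = set0 \/
  [/\ {subset W <= [pred x | `[< A x >]]}, submod_closed [pred x | `[< A x >]] & ~ A v].
have [|A [PA Amax]] := @Zorn_bigcup M P.
  move=> F FP Ftot.
  have [[X [FX X0]]|F0] := pselect (exists X, F X /\ (X !=set0)%classic); last first.
    left; apply/seteqP; split=> // x [X FX Xx]; apply: F0; exists X; split=> //.
    by exists x.
  have subm Y x : F Y -> Y x -> [/\ {subset W <= [pred x | `[< Y x >]]},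
      submod_closed [pred x | `[< Y x >]] & ~ Y v].
    by move=> /FP [->|].
  have [x0 Xx0] := X0; have [XW [X00 _] _] := subm _ _ FX Xx0.
  right; split.
  - by move=> w /XW /asboolP Xw; apply/asboolP; exists X.
  - split=> [|a x y]; first by apply/asboolP; exists X => //; exact/asboolP.
    move=> /asboolP[Y FY Yx] /asboolP[Z FZ Zy]; apply/asboolP.
    have [YZ|ZY] := Ftot _ _ FY FZ.
      exists Z => //; have [_ [_ ZP] _] := subm _ _ FZ Zy.
      by apply/asboolP/ZP; apply/asboolP => //; exact: YZ.
    exists Y => //; have [_ [_ YP] _] := subm _ _ FY Yx.
    by apply/asboolP/YP; apply/asboolP => //; exact: ZY.
  - by case=> Y FY Yv; have [] := subm _ _ FY Yv.
have PW : P [set` W]%classic.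
  right; split; last by move=> /= vW'; rewrite vW' in vW.
    by move=> w wW; apply/asboolP.
  split=> [|a x y /asboolP xW /asboolP yW]; apply/asboolP; first exact: rpred0.
  by rewrite /= rpredD // rpredZ.
case: PA => [A0|[AW AS Av]].
  exfalso; apply: (Amax _ _ PW); rewrite A0; split=> // /(_ 0); apply.
  exact: rpred0.
have A0 : A 0 by case: AS => /asboolP.
have AP a x y : A x -> A y -> A (a *: x + y).
  by case: AS => _ H Ax Ay; apply/asboolP/H; exact/asboolP.
have AD x y : A x -> A y -> A (x + y) by rewrite -{2}[x]scale1r; exact: AP.
have AZ a x : A x -> A (a *: x) by rewrite -[_ *: _]addr0 => Ax; exact: AP.
have AN x : A x -> A (- x) by rewrite -scaleN1r; exact: AZ.
have dec x : exists c, A (x - c *: v).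
  have [Ax|nAx] := pselect (A x); first by exists 0; rewrite scale0r subr0.
  (* [B] is [A + R x]. If it contains [v], the relation can be solved for [x]; otherwise it
     contradicts the maximality of [A]. *)
  pose B : set M := fun y => exists c, A (y - c *: x).
  have [Bv|nBv] := pselect (B v).
    case: Bv => c Ac.
    have c0 : c != 0 by apply/eqP => c0; apply: Av; rewrite c0 scale0r subr0 in Ac.
    exists c^-1; have := AN _ (AZ c^-1 _ Ac).
    by rewrite scalerBr scalerA mulVf // scale1r opprB.
  exfalso; apply: (Amax B).
    split=> [y Ay|]; first by exists 0; rewrite scale0r subr0.
    by move=> /(_ x) H; apply/nAx/H; exists 1; rewrite scale1r subrr.
  right; split=> //.
    by move=> w /AW/asboolP Aw; apply/asboolP; exists 0; rewrite scale0r subr0.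
  split=> [|a y z /asboolP[c yc] /asboolP[d zd]]; apply/asboolP.
    by exists 0; rewrite scale0r subr0.
  exists (a * c + d).
  have -> : a *: y + z - (a * c + d) *: x = a *: (y - c *: x) + (z - d *: x).
    by rewrite scalerDl opprD addrACA scalerBr scalerA.
  exact: AP.
have uniq x c d : A (x - c *: v) -> A (x - d *: v) -> c = d.
  move=> Ac Ad; apply/eqP; rewrite -subr_eq0; apply/negPn/negP => cd; apply: Av.
  have := AZ (c - d)^-1 _ (AD _ _ Ad (AN _ Ac)).
  by rewrite opprB [X in _ *: X]addrC addrA subrK -scalerBl scalerA mulVf ?scale1r.
have /choice [l lP] := dec.
have lL : linear (l : M -> R^o).
  move=> a x y; apply: (uniq (a *: x + y)) => //.
  have -> : a *: x + y - (a * l x + l y) *: v = a *: (x - l x *: v) + (y - l y *: v).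
    by rewrite scalerDl opprD addrACA scalerBr scalerA.
  exact: AP.
exists (mk_linear lL); split=> [|w wW] /=.
  by apply: (uniq v) => //; rewrite scale1r subrr.
apply: (uniq w) => //; rewrite scale0r subr0; apply/asboolP; exact: AW.
Qed.

(** A functional separating one [e j] from the others picks out [x j]. *)
Lemma tens_independent (M N : lmodType R) n (e : 'I_n -> M) (x : 'I_n -> N) :
  (forall c : 'I_n -> R, \sum_i c i *: e i = 0 -> forall i, c i = 0) ->
  \sum_i tens (e i) (x i) = 0 -> forall i, x i = 0.
Proof.
move=> ind ex j.
pose W := span [set e i | i in [set i | i != j]]%classic.
have ejW : e j \notin W.
  apply/negP => ejW.
  (* If [e j] were a combination with coefficient 0 at [j], subtracting it would give a relation
     with coefficient 1 at [j]. *)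
  pose A : {pred M} := fun m =>
    `[< exists2 c : 'I_n -> R, c j = 0 & m = \sum_i c i *: e i >].
  have AS : submod_closed A.
    split=> [|a m m' /asboolP[c cj ->] /asboolP[c' cj' ->]]; apply/asboolP.
      by exists (fun=> 0) => //; rewrite big1 // => i _; rewrite scale0r.
    exists (fun i => a * c i + c' i); first by rewrite cj cj' mulr0 addr0.
    rewrite scaler_sumr -big_split; apply: eq_bigr => i _.
    by rewrite scalerDl scalerA.
  pose AS' : submodClosed M := HB.pack A
    (GRing.isSubmodClosed.Build R M A (GRing.submod_closed_semi AS)).
  have /asboolP[c cj ejE] : e j \in AS'.
    apply: span_min ejW => _ [i /= ij <-]; apply/asboolP.
    exists (fun k => (k == i)%:R); first by rewrite eq_sym (negPf ij).
    rewrite (bigD1 i) //= eqxx scale1r big1 ?addr0 // => k /negPf ->.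
    by rewrite scale0r.
  have := ind (fun i => (i == j)%:R - c i) _ j; rewrite eqxx cj subr0 => H.
  suff : 1 = 0 :> R by move/eqP; rewrite oner_eq0.
  apply: H; under eq_bigr do rewrite scalerBl.
  rewrite sumrB -ejE (bigD1 j) //= eqxx scale1r big1 ?addr0 ?subrr // => i /negPf ->.
  by rewrite scale0r.
have [l [lj lW]] := separating_functional ejW.
have fl n' : linear (fun m => (l m : R) *: (n' : N)).
  by move=> a m m'; rewrite linearP scalerDl scalerA.
have fr m : linear (fun n' : N => (l m : R) *: n').
  by move=> a y y'; rewrite scalerDr !scalerA mulrC.
(* Apply [l] tensored with the identity of [N] to the relation; only [x j] survives. *)
have := congr1 (tens_lift fl fr) ex; rewrite linear0 linear_sum.
rewrite (bigD1 j) // tens_liftE lj scale1r big1 => [/=|i ij]; first by rewrite addr0.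
by rewrite [LHS]tens_liftE lW ?scale0r //; apply: mem_span; exists i.
Qed.

End LinearAlgebra.

Section TensorInduction.
Variables (R : fieldType) (M N : lmodType R).

(** The elements satisfying [Q] form a subspace; the quotient map by it vanishes on pure tensors,
    hence everywhere. *)
Lemma tens_ind (Q : tensor M N -> Prop) :
  Q 0 -> (forall a z t, Q z -> Q t -> Q (a *: z + t)) ->
  (forall m n, Q (tens m n)) -> forall z, Q z.
Proof.
move=> Q0 QP Qt.
pose A : {pred tensor M N} := fun z => `[< Q z >].
have AS : submod_closed A.
  by split=> [|a z t /asboolP Qz /asboolP Qt']; apply/asboolP => //; apply: QP.
pose A' : submodClosed (tensor M N) := HB.pack A
  (GRing.isSubmodClosed.Build R (tensor M N) A (GRing.submod_closed_semi AS)).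
pose z0 : {linear tensor M N -> quotmod A'} := mk_linear (fun a x y =>
  esym (etrans (addr0 _) (scaler0 _ a)) :
    (fun=> 0 : quotmod A') (a *: x + y) = a *: 0 + 0).
move=> z; have : quot_pi A' z = quot_pi A' 0.
  rewrite linear0; apply: (tens_ext (g := quot_pi A') (h := z0)) => m n.
  by apply: quot_pi_eq0; apply/asboolP.
by move/quot_pi_eq; rewrite subr0 => /asboolP.
Qed.

End TensorInduction.

Section TensZ.
Variables (R : fieldType) (M N : lmodType R).

Lemma tensZl a (m : M) (n : N) : tens (a *: m) n = a *: tens m n.
Proof. exact: (linearZ_LR (mk_linear (tens_linearl n))). Qed.

Lemma tensZr a (m : M) (n : N) : tens m (a *: n) = a *: tens m n.
Proof. exact: (linearZ_LR (mk_linear (tens_linearr m))). Qed.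

End TensZ.

(** * Direct limits and smoothness *)

Section Dirlim.
Variables (R : fieldType) (G : groupType) (Gamma : groupClosed G) (X : csys R Gamma).

Lemma dirlim_in_tr S S' (p : csub 1%g S S') x :
  dirlim_in X S' (csys_tr X p x) = dirlim_in X S x.
Proof. exact: dirlim_fun_tr. Qed.

Lemma dirlim_in_ind (z : dirlim X) : exists S x, z = dirlim_in X S x.
Proof. exact: dirlim_ind. Qed.

Lemma dirlim_in_eq0 S x : dirlim_in X S x = 0 ->
  exists T (p : csub 1%g S T), csys_tr X p x = 0.
Proof.
rewrite -(linear0 (dirlim_in X S)) => /dirlim_fun_eq[T [p [q]]].
by rewrite linear0; exists T, p.
Qed.

Lemma dirlim_in_eq0_seq S (l : seq (X S)) : (forall x, x \in l -> dirlim_in X S x = 0) ->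
  exists T (p : csub 1%g S T), forall x, x \in l -> csys_tr X p x = 0.
Proof.
elim: l => [|y l IHl] l0; first by exists S, (@csub_refl _ _ S).
have [x xl|T [p pl]] := IHl; first by apply: l0; rewrite inE xl orbT.
have : dirlim_in X T (csys_tr X p y) = 0.
  by rewrite dirlim_in_tr l0 // mem_head.
move=> /dirlim_in_eq0[T' [q qy]]; exists T', (csub1l p q) => x.
rewrite -(csys_compl p q) inE => /orP[/eqP -> //|/pl ->].
by rewrite linear0.
Qed.

Lemma gact_dirlim_in g S S' (p : csub g S S') x :
  gact (dirlim X) g (dirlim_in X S x) = dirlim_in X S' (csys_tr X p x).
Proof. exact: dirlim_act_funE. Qed.

(** An element of [S] normalizes [S], so it acts on classes from level [S] through an endomorphism
    of [X S]. If these are trivial, [S] itself fixes the class. *)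
Lemma dirlim_smooth :
  (forall S s (p : csub s S S) x, s \in S -> csys_tr X p x = x) ->
  smooth Gamma (dirlim X).
Proof.
move=> trS z; have [S [x ->]] := dirlim_in_ind z.
apply/asboolP; exists S => s sS.
have p : csub s S S by move=> x' xS; rewrite conjgE !gpredM ?gpredV.
by rewrite (gact_dirlim_in p) trS.
Qed.

Section Lift.
Variables (W : gmod R G) (f : forall S, {linear X S -> W}).
Hypothesis f_tr : forall g S S' (p : csub g S S') x,
  f S' (csys_tr X p x) = gact W g (f S x).

Definition dirlim_lift_fun (z : dirlim X) : W := f _ (germ_val (repr z)).

(** The case [g = 1] of [f_tr] is compatibility with restriction, which makes the value independent
    of the representative. *)
Lemma dirlim_lift_funE S x : dirlim_lift_fun (dirlim_in X S x) = f S x.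
Proof.
have [T [p [q e]]] := dirlim_repr x.
by rewrite /dirlim_lift_fun -[LHS]gact1 -(f_tr p) e f_tr gact1.
Qed.

Fact dirlim_lift_linear : linear dirlim_lift_fun.
Proof.
move=> a z t; have [S [x [y [-> ->]]]] := dirlim_ind2 z t.
have E (u : X S) : dirlim_lift_fun (dirlim_fun u) = _ := dirlim_lift_funE u.
by rewrite -(dirlim_fun_linear a x y) !E !linearP.
Qed.

Fact dirlim_lift_act g z :
  mk_linear dirlim_lift_linear (gact (dirlim X) g z) =
  gact W g (mk_linear dirlim_lift_linear z).
Proof.
have [S [x ->]] := dirlim_in_ind z.
rewrite (gact_dirlim_in (@csub_capr _ _ S S g)).
by rewrite [LHS]dirlim_lift_funE f_tr [in RHS]/= dirlim_lift_funE.
Qed.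

Definition dirlim_lift : gmod_hom (dirlim X) W := GmodHom dirlim_lift_act.

Lemma dirlim_liftE S x : dirlim_lift (dirlim_in X S x) = f S x.
Proof. exact: dirlim_lift_funE. Qed.

End Lift.
End Dirlim.

Section Smooth.
Variables (R : fieldType) (G : groupType) (Gamma : groupClosed G).

Lemma Vinf_smooth (V : gmod R G) : smooth Gamma (Vinf Gamma V).
Proof.
case=> v Vv; have /asboolP[S Sv] := Vv; apply/asboolP; exists S => s sS.
by apply: val_inj; rewrite /= Sv.
Qed.

(** Smooth elements form a subspace, and a pure tensor is fixed by the intersection of the subgroups
    fixing its factors. *)
Lemma tpow_smooth (V W : gmod R G) n :
  smooth Gamma V -> smooth Gamma W -> smooth Gamma (tpow_gmod V W n).
Proof.
move=> Vs Ws; elim: n => [|n IHn] //.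
apply: tens_ind => [|a z t zs ts|v w]; first exact: rpred0.
  by apply: rpredD => //; apply: rpredZ.
have /asboolP[S Sv] := Vs v; have /asboolP[S' Sw] := IHn w.
apply/asboolP; exists (cong_capJ S S' 1%g) => s /andP[sS]; rewrite conjg1 => sS'.
rewrite [LHS]tens_mapE Sv //; congr tens; exact: Sw.
Qed.

End Smooth.

(** * Homomorphisms on a finitely generated group *)

Section HomBasis.
Variables (R : fieldType) (G : groupType) (P : {pred G}) (S : groupClosed G).

Lemma homP_add (M : lmodType R) (f : homP P S M) x y :
  homP_fun f (x * y)%g = homP_fun f x + homP_fun f y.
Proof. by have /asboolP[fD _] := valP f; apply: fD. Qed.

Lemma homP_fun1 (M : lmodType R) (f : homP P S M) : homP_fun f 1%g = 0.
Proof. by apply: (addrI (homP_fun f 1%g)); rewrite -homP_add mulg1 addr0. Qed.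

Lemma homP_funV (M : lmodType R) (f : homP P S M) x :
  homP_fun f x^-1%g = - homP_fun f x.
Proof. by apply: (addrI (homP_fun f x)); rewrite -homP_add mulgV homP_fun1 subrr. Qed.

Lemma homP_funP (M : lmodType R) (f : homP P S M) (x : subgrp S) :
  val x \in P -> homP_fun f x = 0.
Proof. by have /asboolP[_ fP] := valP f; apply: fP. Qed.

Lemma homP_ext (M : lmodType R) (f f' : homP P S M) :
  homP_fun f =1 homP_fun f' -> f = f'.
Proof. by move=> ff'; apply: val_inj; apply/funext. Qed.

(** [s] and the formal combination of the [b i] with coefficients [c i] have
    the same class in the universal target of homomorphisms vanishing on [P]. *)
Definition hom_coords n (b : 'I_n -> subgrp S) (c : 'I_n -> R) (s : subgrp S) : Prop :=
  forall (M : lmodType R) (f : homP P S M),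
    homP_fun f s = \sum_i c i *: homP_fun f (b i).

Definition hom_spans n (b : 'I_n -> subgrp S) : Prop :=
  forall s, exists c, hom_coords b c s.

Lemma fg_hom_spans : finitely_generated S ->
  exists n, exists b : 'I_n -> subgrp S, hom_spans b.
Proof.
move=> [l lS lgen].
pose b (i : 'I_(size l)) : subgrp S := Subgrp (lS _ (mem_nth 1%g (ltn_ord i))).
exists (size l), b.
pose K : {pred G} :=
  fun x => `[< exists s : subgrp S, val s = x /\ exists c, hom_coords b c s >].
have KG : group_closed K.
  split=> [|_ _ /asboolP[x [<- [c cx]]] /asboolP[y [<- [d dy]]]]; apply/asboolP.
    exists 1%g; split=> //; exists (fun=> 0) => M f.
    by rewrite homP_fun1 big1 // => i _; rewrite scale0r.
  exists (x * y^-1)%g; split=> //; exists (fun i => c i - d i) => M f.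
  rewrite homP_add homP_funV cx dy -sumrB.
  by apply: eq_bigr => i _; rewrite scalerBl.
have SK : {subset S <= mk_group KG}.
  apply: lgen => _ /(nthP 1%g)[i il <-]; apply/asboolP.
  exists (b (Ordinal il)); split=> //; exists (fun k => (k == Ordinal il)%:R) => M f.
  rewrite (bigD1 (Ordinal il)) //= eqxx scale1r big1 ?addr0 // => k /negPf ->.
  by rewrite scale0r.
move=> s; have /asboolP[s' [ss' cs]] := SK _ (valP s).
by rewrite -(val_inj ss').
Qed.

(** The difference [c - c'] is a relation among the [f (b i)] valid for all [f] at once, so [b j]
    can be eliminated uniformly. *)
Lemma hom_spans_reduce n (b : 'I_n.+1 -> subgrp S) c c' s j :
  hom_spans b -> hom_coords b c s -> hom_coords b c' s -> c j != c' j ->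
  hom_spans (b \o lift j).
Proof.
move=> bS cs c's cj t; have [e et] := bS t.
exists (fun i => e (lift j i) - (c (lift j i) - c' (lift j i)) / (c j - c' j) * e j).
move=> M f; rewrite et.
apply: (@sum_eliminate _ _ _ (fun i => c i - c' i)); last by rewrite subr_eq0.
under eq_bigr do rewrite scalerBl.
by rewrite sumrB -cs -c's subrr.
Qed.

(** A minimal spanning family has unique, hence additive, coordinates. *)
Lemma hom_basis : finitely_generated S ->
  exists n (b : 'I_n -> subgrp S) (h : 'I_n -> homPR R P S),
  forall (M : lmodType R) (f : homP P S M) s,
    homP_fun f s = \sum_i (homP_fun (h i) s : R) *: homP_fun f (b i).
Proof.
move=> /fg_hom_spans exn.
pose Q n := `[< exists b : 'I_n -> subgrp S, hom_spans b >].
have exQ : exists n, Q n by have [n nb] := exn; exists n; apply/asboolP.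
have [n /asboolP[b bS] nmin] := ex_minnP exQ.
have uniq s c c' : hom_coords b c s -> hom_coords b c' s -> c =1 c'.
  move=> cs c's j; apply/eqP/negPn/negP.
  case: n b bS nmin c c' j cs c's => [|n] b bS nmin c c' j cs c's cj; first by case: (j).
  suff /nmin : Q n by rewrite ltnn.
  by apply/asboolP; exists (b \o lift j); apply: hom_spans_reduce cj.
have [h hP] := choice bS.
(* By uniqueness the coordinates of a product are the sums and those of an element of [P] are
   zero. *)
have hH i : (fun s => h s i : R^o) \in homP_pred P (S := S) (M := R^o).
  apply/asboolP; split=> [x y|x xP].
    apply: (uniq (x * y)%g _ (fun i => h x i + h y i)) => // M f.
    rewrite homP_add !hP -big_split; apply: eq_bigr => k _.
    by rewrite scalerDl.
  apply: (uniq x _ (fun=> 0)) => // M f.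
  by rewrite homP_funP // big1 // => k _; rewrite scale0r.
by exists n, b, (fun i => Submod (hH i)) => M f s; rewrite hP.
Qed.

End HomBasis.

Section HomTens.
Variables (R : fieldType) (G : groupType) (P : {pred G}) (S : groupClosed G).

Fact homP_fun_linear (M : lmodType R) s : linear (fun f : homP P S M => homP_fun f s).
Proof. by []. Qed.

Lemma homP_fun_sum (M : lmodType R) n (c : 'I_n -> R) (f : 'I_n -> homP P S M) s :
  homP_fun (\sum_i c i *: f i) s = \sum_i c i *: homP_fun (f i) s.
Proof.
rewrite -[LHS]/(mk_linear (homP_fun_linear (M := M) s) _) linear_sum.
by apply: eq_bigr => i _; rewrite linearZ.
Qed.

Lemma hom_tens_sum (M : lmodType R) n (h : 'I_n -> homPR R P S) (m : 'I_n -> M) s :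
  homP_fun (hom_tens P S M (\sum_i tens (h i) (m i))) s =
  \sum_i (homP_fun (h i) s : R) *: m i.
Proof.
rewrite linear_sum -[LHS]/(mk_linear (homP_fun_linear (M := M) s) _) linear_sum.
by apply: eq_bigr => i _; rewrite tens_liftE.
Qed.

(** The inverse sends [f] to the sum of the [h i (x) f (b i)]. It recovers [k (x) m] because the
    basis formula for [k] itself expands [k] in the [h i]. *)
Lemma hom_tens_bij (M : lmodType R) : finitely_generated S ->
  exists I : {linear homP P S M -> tensor (homPR R P S) M},
  cancel I (hom_tens P S M) /\ cancel (hom_tens P S M) I.
Proof.
move=> Sfg; have [n [b [h hb]]] := hom_basis R P Sfg.
pose I (f : homP P S M) := \sum_i tens (h i) (homP_fun f (b i)).
have IL : linear I.
  move=> a f f'; rewrite scaler_sumr -big_split; apply: eq_bigr => i _.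
  exact: tens_linearr.
exists (mk_linear IL); split.
  by move=> f; apply: homP_ext => s; rewrite [LHS]hom_tens_sum hb.
apply: (tens_ext (g := mk_linear IL \o hom_tens P S M) (h := idfun)) => k m.
rewrite [LHS]/(I (hom_tens P S M (tens k m))) tens_liftE /I [RHS]/=.
have kE : k = \sum_i (homP_fun k (b i) : R) *: h i.
  by apply: homP_ext => s; rewrite hb homP_fun_sum; apply: eq_bigr => i _; exact: mulrC.
rewrite [in RHS]kE.
rewrite -[RHS]/(mk_linear (tens_linearl (M := homPR R P S) m) _) linear_sum.
by apply: eq_bigr => i _; rewrite /= tensZl [LHS]tensZr.
Qed.
End HomTens.

(** * The order-lowering maps *)

Section Lowering.
Variables (R : fieldType) (G : groupType) (Gamma : groupClosed G).
Variables (P : {pred G}) (hP : conj_invariant P).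
Local Notation cong := (cong Gamma).
Hypothesis fg : forall S : cong, finitely_generated S.

Definition hom_untens (S : cong) (M : lmodType R) :
    {linear homP P S M -> tensor (homPR R P S) M} :=
  projT1 (cid (hom_tens_bij P M (fg S))).

Lemma hom_untensK (S : cong) (M : lmodType R) :
  cancel (hom_untens S M) (hom_tens P S M).
Proof. by rewrite /hom_untens; case: cid => I []. Qed.

Lemma hom_tensK (S : cong) (M : lmodType R) :
  cancel (hom_tens P S M) (hom_untens S M).
Proof. by rewrite /hom_untens; case: cid => I []. Qed.

Lemma lower_class (V : gmod R G) (S : cong) q v (Hv : v \in H0 P V S q.+1) s :
  homP_fun (lower hP V S q (Hbar_class Hv)) s =
  Hbar_class (H0_lower hP (subgrp_valP s) Hv).
Proof. by rewrite /lower [subq_lift _ _]subq_liftE. Qed.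

(** If every [(s - 1) v] is killed by [I^q], then [v] is killed by [I^(q+1)], so its class of order
    [q + 2] is zero. Order 1 is excluded: lowering has zero target there. *)
Lemma lower_inj (V : gmod R G) (S : cong) q (x : Hbar P V S q.+2) :
  (forall s, homP_fun (lower hP V S q.+1 x) s = 0) -> x = 0.
Proof.
have [v [Hv ->]] := Hbar_ind x => H.
apply: quot_pi_eq0; apply/H0P; split; last by have /H0P[] := Hv.
move=> s sS; have := H (Subgrp sS); rewrite lower_class.
rewrite -(linear0 (quot_pi _)) => /quot_pi_eq.
by rewrite subr0 => /H0P[].
Qed.

(** The index is shifted: [q] steps lead from order [q + 1] down to order 1. *)
Fixpoint iter_lowering (V : gmod R G) (S : cong) q :
    {linear Hbar P V S q.+1 -> tpow (homPR R P S) q (Hbar P V S 1)} :=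
  if q is q'.+1 then
    tens_map idfun (iter_lowering V S q') \o hom_untens S _ \o lower hP V S q'.+1
  else idfun.

Lemma iter_loweringP V S q : iter_lower hP (q := q.+1) (iter_lowering V S q).
Proof.
elim: q => [|q IHq]; first exact: IterLower1.
apply: (IterLowerS IHq) => x; exists (hom_untens S _ (lower hP V S q.+1 x)) => //.
exact: hom_untensK.
Qed.

Lemma hom_tens_conj g (S S' : cong) (p : csub g S S') (M N : lmodType R)
    (f : {linear M -> N}) (t : tensor (homPR R P S) M) s :
  homP_fun (hom_tens P S' N (tens_map (hom_tr R hP p) f t)) s =
  f (homP_fun (hom_tens P S M t) (conj_elt p s)).
Proof.
move: t; apply: tens_ind => [|a z t zE tE|h m].
- by rewrite !linear0.
- by rewrite !linearP homP_fun_linear zE tE.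
- by rewrite tens_mapE !tens_liftE [RHS]linearZ.
Qed.

(** Fuses the passage to the limit with one lowering step, so that an induction on [q] meets the
    composite of order one less. *)
Lemma target_in_loweringS (V : gmod R G) (S : cong) q (x : Hbar P V S q.+2) :
  target_in hP V q.+2 S (iter_lowering V S q.+1 x) =
  tens_map (dirlim_in (hom_sys R Gamma hP) S)
    (target_in hP V q.+1 S \o iter_lowering V S q)
    (hom_untens S _ (lower hP V S q.+1 x)).
Proof.
rewrite -[LHS]/(tens_map (dirlim_in (hom_sys R Gamma hP) S) (target_in hP V q.+1 S)
  (tens_map idfun (iter_lowering V S q) (hom_untens S _ (lower hP V S q.+1 x)))).
move: (hom_untens _ _ _); apply: tens_ind => [|a z t zE tE|h m].
- by rewrite !linear0.
- by rewrite !linearP zE tE.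
- by rewrite !tens_mapE.
Qed.

(** Covers both the action of [g] and functoriality in [V]. *)
Lemma iter_lowering_nat (V W : gmod R G) g (S S' : cong) (p : csub g S S')
    (F : forall q, {linear Hbar P V S q -> Hbar P W S' q})
    (A : {linear Homhat R Gamma hP -> Homhat R Gamma hP})
    (B : {linear Vinf Gamma V -> Vinf Gamma W}) :
  (forall h, A (dirlim_in (hom_sys R Gamma hP) S h) =
     dirlim_in (hom_sys R Gamma hP) S' (hom_tr R hP p h)) ->
  (forall x, Hbar1_in P W S' (F 1%N x) = B (Hbar1_in P V S x)) ->
  (forall q x s, homP_fun (lower hP W S' q (F q.+1 x)) s =
     F q (homP_fun (lower hP V S q x) (conj_elt p s))) ->
  forall q x, target_in hP W q.+1 S' (iter_lowering W S' q (F q.+1 x)) =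
    tpow_map A B q (target_in hP V q.+1 S (iter_lowering V S q x)).
Proof.
move=> FA FB Flow; elim=> [|q IHq] x; first exact: FB.
rewrite !target_in_loweringS; set u := hom_untens S _ _.
(* Since [hom_tens] is injective, the two tensors can be compared as homomorphisms, value by
   value. *)
have -> : hom_untens S' _ (lower hP W S' q.+1 (F q.+2 x)) =
    tens_map (hom_tr R hP p) (F q.+1) u.
  apply: (can_inj (@hom_tensK S' _)); rewrite hom_untensK; apply: homP_ext => s.
  by rewrite Flow hom_tens_conj /u hom_untensK.
rewrite -[tpow_map A B q.+1]/(tens_map A (tpow_map A B q)).
move: u; apply: tens_ind => [|a z t zE tE|h m].
- by rewrite !linear0.
- by rewrite !linearP zE tE.
- by rewrite !tens_mapE FA [in LHS]/= IHq.
Qed.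
End Lowering.

(** * The embedding of the direct limit and its injectivity *)

Section Embedding.
Variables (R : fieldType) (G : groupType) (Gamma : groupClosed G).
Variables (P : {pred G}) (hP : conj_invariant P).
Local Notation cong := (cong Gamma).
Hypothesis fg : forall S : cong, finitely_generated S.

Definition Hbar_emb (V : gmod R G) q (S : cong) :
    {linear Hbar_sys Gamma hP V q.+1 S -> target Gamma hP V q.+1} :=
  target_in hP V q.+1 S \o iter_lowering hP fg V S q.

Lemma Hbar1_in_class (V : gmod R G) (S : cong) v (Hv : v \in H0 P V S 1) :
  val (Hbar1_in P V S (Hbar_class Hv)) = v.
Proof. by rewrite /Hbar1_in [subq_lift _ _]subq_liftE. Qed.

(** Rests on [(s - 1) g v = g (s^g - 1) v], where [s^g = g^-1 s g]. *)
Lemma lower_tr (V : gmod R G) g (S S' : cong) (p : csub g S S') q x s :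
  homP_fun (lower hP V S' q (Hbar_tr hP V q.+1 p x)) s =
  Hbar_tr hP V q p (homP_fun (lower hP V S q x) (conj_elt p s)).
Proof.
have [v [Hv ->]] := Hbar_ind x.
rewrite Hbar_trE !lower_class Hbar_trE; apply/Hbar_class_eq.
by rewrite linearB -!gactM /= -conjgC subrr rpred0.
Qed.

Lemma Hbar_emb_tr (V : gmod R G) q g (S S' : cong) (p : csub g S S') x :
  Hbar_emb V q S' (csys_tr (Hbar_sys Gamma hP V q.+1) p x) =
  gact (target Gamma hP V q.+1) g (Hbar_emb V q S x).
Proof.
apply: (iter_lowering_nat fg (p := p) (F := fun k => Hbar_tr hP V k p)
  (A := gact _ g) (B := gact _ g)) => [h|y|k y s].
- exact: gact_dirlim_in.
- have [v [Hv ->]] := Hbar_ind y; rewrite Hbar_trE; apply: val_inj.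
  by rewrite -[RHS]/(gact V g (val _)) !Hbar1_in_class.
- exact: lower_tr.
Qed.

Lemma Hbar_emb_map (V W : gmod R G) (f : gmod_hom V W) q (S : cong) x :
  Hbar_emb W q S (Hbar_map P f q.+1 S x) = target_map Gamma hP f q.+1 (Hbar_emb V q S x).
Proof.
apply: (iter_lowering_nat fg (p := @csub_refl _ _ S) (F := fun k => Hbar_map P f k S)
  (A := idfun) (B := Vinf_map Gamma f)) => [h|y|k y s].
- by rewrite hom_tr_id.
- have [v [Hv ->]] := Hbar_ind y; rewrite [Hbar_map _ _ _ _ _]subq_mapE; apply: val_inj.
  by rewrite -[RHS]/(f (val _)) !Hbar1_in_class.
- have [v [Hv ->]] := Hbar_ind y.
  rewrite [Hbar_map _ _ _ _ _]subq_mapE !lower_class [RHS]subq_mapE.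
  by apply/Hbar_class_eq; rewrite linearB gmod_homP /= conjg1 subrr rpred0.
Qed.

Lemma lower_finite (V : gmod R G) (S : cong) q (x : Hbar P V S q.+2) :
  exists n (h : 'I_n -> homPR R P S) (m : 'I_n -> Hbar P V S q.+1),
  forall s, homP_fun (lower hP V S q.+1 x) s = \sum_i (homP_fun (h i) s : R) *: m i.
Proof.
have [n [b [h hb]]] := hom_basis R P (fg S).
by exists n, h, (fun i => homP_fun (lower hP V S q.+1 x) (b i)) => s; rewrite hb.
Qed.

(** The subgroup [S'] is free so that, for [n] minimal, the [h i] are independent
    in the direct limit and not merely over one subgroup. *)
Definition lower_terms (V : gmod R G) (S : cong) q (x : Hbar P V S q.+2) n : Prop :=
  exists (S' : cong) (p : csub 1%g S S') (h : 'I_n -> homPR R P S')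
    (m : 'I_n -> Hbar P V S' q.+1),
  forall s, homP_fun (lower hP V S' q.+1 (Hbar_tr hP V q.+2 p x)) s =
    \sum_i (homP_fun (h i) s : R) *: m i.

(** The relation already holds on a smaller subgroup [T]. There it expresses [h j] through the other
    [h i], and substituting turns [m i] into [m i - (c i / c j) m j]. *)
Lemma lower_terms_reduce (V : gmod R G) (S : cong) q (x : Hbar P V S q.+2) n
    (S' : cong) (p : csub 1%g S S') (h : 'I_n.+1 -> homPR R P S')
    (m : 'I_n.+1 -> Hbar P V S' q.+1) (c : 'I_n.+1 -> R) j :
  (forall s, homP_fun (lower hP V S' q.+1 (Hbar_tr hP V q.+2 p x)) s =
    \sum_i (homP_fun (h i) s : R) *: m i) ->
  \sum_i c i *: dirlim_in (hom_sys R Gamma hP) S' (h i) = 0 -> c j != 0 ->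
  lower_terms x n.
Proof.
move=> xE ch cj.
have : dirlim_in (hom_sys R Gamma hP) S' (\sum_i c i *: h i) = 0.
  by rewrite linear_sum -[RHS]ch; apply: eq_bigr => i _; rewrite linearZ.
move=> /dirlim_in_eq0[T [r cT]].
pose h' i := hom_tr R hP r (h i); pose m' i := Hbar_tr hP V q.+1 r (m i).
have ch' s : \sum_i c i * (homP_fun (h' i) s : R) = 0.
  have := congr1 (fun f : homPR R P T => homP_fun f s) cT.
  rewrite linear_sum; under eq_bigr do rewrite linearZ.
  by rewrite homP_fun_sum.
exists T, (csub1l p r), (fun i => h' (lift j i)),
  (fun i => m' (lift j i) - (c (lift j i) / c j) *: m' j) => s.
have -> : Hbar_tr hP V q.+2 (csub1l p r) x = Hbar_tr hP V q.+2 r (Hbar_tr hP V q.+2 p x).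
  by rewrite (csys_compl (X := Hbar_sys Gamma hP V q.+2) p r (csub1l p r)).
have -> : homP_fun (lower hP V T q.+1 (Hbar_tr hP V q.+2 r (Hbar_tr hP V q.+2 p x))) s =
    \sum_i (homP_fun (h' i) s : R) *: m' i.
  by rewrite lower_tr xE linear_sum; apply: eq_bigr => i _; rewrite linearZ.
have -> : \sum_i (homP_fun (h' i) s : R) *: m' i =
    \sum_i (homP_fun (h' i) s : R) *: (m' i - (c i / c j) *: m' j).
  under [RHS]eq_bigr do rewrite scalerBr scalerA mulrCA mulrA.
  by rewrite sumrB -scaler_suml -mulr_suml ch' mul0r scale0r subr0.
by rewrite (bigD1_ord j) //= mulfV // scale1r subrr scaler0 add0r.
Qed.

Lemma Hbar_emb_inj (V : gmod R G) q (S : cong) x :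
  Hbar_emb V q S x = 0 -> dirlim_in (Hbar_sys Gamma hP V q.+1) S x = 0.
Proof.
elim: q S x => [|q IHq] S x.
  move=> x0; suff -> : x = 0 by rewrite linear0.
  have [v [Hv xE]] := Hbar_ind x; rewrite {x}xE in x0 *.
  apply: quot_pi_eq0; apply/eqP.
  exact: etrans (esym (Hbar1_in_class Hv)) (congr1 val x0).
move=> x0.
pose Q n := `[< lower_terms x n >].
have exQ : exists n, Q n.
  have [n [h [m hm]]] := lower_finite x; exists n; apply/asboolP.
  exists S, (@csub_refl _ _ S), h, m => s.
  by rewrite Hbar_tr_id.
have [n /asboolP[S' [p [h [m xE]]]] nmin] := ex_minnP exQ.
pose y := Hbar_tr hP V q.+2 p x.
have ind (c : 'I_n -> R) :
    \sum_i c i *: dirlim_in (hom_sys R Gamma hP) S' (h i) = 0 -> forall i, c i = 0.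
  move=> ch j; apply/eqP/negPn/negP.
  case: n nmin h m xE c ch j => [|n] nmin h m xE c ch j; first by case: j.
  move=> cj; suff /nmin : Q n by rewrite ltnn.
  exact/asboolP/(lower_terms_reduce xE ch cj).
(* The sum is the image of [y], which is a restriction of [x] and so has the same image 0. *)
have y0 : \sum_i tens (dirlim_in (hom_sys R Gamma hP) S' (h i))
    (Hbar_emb V q S' (m i)) = 0.
  have : Hbar_emb V q.+1 S' y = 0.
    by rewrite [LHS](Hbar_emb_tr p) x0 linear0.
  rewrite [Hbar_emb _ _ _ _]target_in_loweringS.
  have -> : hom_untens P fg S' _ (lower hP V S' q.+1 y) = \sum_i tens (h i) (m i).
    apply: (can_inj (@hom_tensK _ _ _ P fg S' _)); rewrite hom_untensK.
    by apply: homP_ext => s; rewrite xE hom_tens_sum.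
  by rewrite linear_sum => {2}<-; apply: eq_bigr => i _; rewrite tens_mapE.
(* Independence separates the terms, so each [m i] has image zero and the induction hypothesis
   applies to it. *)
have m0 z : z \in [seq m i | i : 'I_n] -> dirlim_in (Hbar_sys Gamma hP V q.+1) S' z = 0.
  by move=> /mapP[i _ ->]; apply: IHq; apply: tens_independent ind y0 i.
have [T [r rm]] := dirlim_in_eq0_seq (X := Hbar_sys Gamma hP V q.+1) m0.
(* All [m i] vanish on [T], so the restriction of [y] to [T] is lowered to zero. *)
have yT : Hbar_tr hP V q.+2 r y = 0.
  apply: (lower_inj (hP := hP)) => s; rewrite lower_tr xE linear_sum big1 // => i _.
  have rmi : Hbar_tr hP V q.+1 r (m i) = 0 by apply: rm; apply: map_f; rewrite mem_enum.
  by rewrite linearZ rmi; exact: scaler0.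
rewrite -(dirlim_in_tr p) -(dirlim_in_tr r).
by rewrite [csys_tr _ r _]yT linear0.
Qed.

(** Since [s - 1] lowers the order, [S] acts trivially on the quotient at level [S]. *)
Lemma Lmod_smooth (V : gmod R G) q : smooth Gamma (Lmod Gamma hP V q).
Proof.
apply: dirlim_smooth => S s p x sS.
have [v [Hv ->]] := Hbar_ind x; rewrite [LHS]Hbar_trE.
by apply/Hbar_class_eq; apply: (H0_sub hP sS Hv).
Qed.

(** A homomorphism to a commutative group is unchanged by conjugation with elements of its
    domain. *)
Lemma Homhat_smooth : smooth Gamma (Homhat R Gamma hP).
Proof.
apply: dirlim_smooth => S s p f sS; apply: homP_ext => x.
rewrite -[LHS]/(homP_fun f (conj_elt p x)).
have -> : conj_elt p x = ((Subgrp sS)^-1 * x * Subgrp sS)%g.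
  by apply: val_inj; rewrite /= conjgE mulgA.
by rewrite !homP_add homP_funV addrAC addNr add0r.
Qed.

End Embedding.

Theorem proposition1p2p2 (R : fieldType) (G : groupType) (Gamma : groupClosed G)
    (hecke : hecke_pair Gamma) (fg : finitely_generated Gamma)
    (P : {pred G}) (hP : conj_invariant P) (q : nat) (q_ge1 : (1 <= q)%N) :
  exists phi : forall V : gmod R G,
      gmod_hom (Lmod Gamma hP V q) (target Gamma hP V q),
  [/\ forall V : gmod R G,
        smooth Gamma (Lmod Gamma hP V q) /\ smooth Gamma (target Gamma hP V q),
      forall V : gmod R G, injective (phi V),
      forall (V W : gmod R G) (f : gmod_hom V W) (x : Lmod Gamma hP V q),
        phi W (Lmod_map Gamma hP f q x) = target_map Gamma hP f q (phi V x)
    & forall (V : gmod R G) (S : cong Gamma),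
        exists2 D : {linear Hbar P V S q ->
                       tpow (homPR R P S) q.-1 (Hbar P V S 1)},
          iter_lower hP D &
          forall x : Hbar P V S q,
            phi V (dirlim_in (Hbar_sys Gamma hP V q) S x) =
            target_in hP V q S (D x)].
Proof.
case: q q_ge1 => // q _; have Sfg (S : cong Gamma) := cong_fg S hecke fg.
exists (fun V => dirlim_lift (@Hbar_emb_tr _ _ _ _ hP Sfg V q)); split.
- move=> V; split; first exact: Lmod_smooth.
  by apply: tpow_smooth; [exact: Homhat_smooth | exact: Vinf_smooth].
(* Both elements come from a common level [S], so their difference can be tested there. *)
- move=> V x y; have [S [x' [y' [-> ->]]]] := dirlim_ind2 x y.
  pose in_S := dirlim_in (Hbar_sys Gamma hP V q.+1) S.
  rewrite -[dirlim_fun x']/(in_S x') -[dirlim_fun y']/(in_S y') !dirlim_liftE => xy.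
  apply/eqP; rewrite -subr_eq0 -linearB; apply/eqP.
  apply: (Hbar_emb_inj (hP := hP) (fg := Sfg)).
  by rewrite linearB xy subrr.
- move=> V W f x; have [S [x' ->]] := dirlim_in_ind x.
  rewrite [Lmod_map _ _ _ _ _]dirlim_map_funE !dirlim_liftE.
  exact: Hbar_emb_map.
- move=> V S; exists (iter_lowering hP Sfg V S q); first exact: iter_loweringP.
  by move=> x; rewrite dirlim_liftE.
Qed.
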